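(* Let $\Omega\subset\mathbb{R}^n$ be a bounded domain with smooth boundary containing the origin, let $1<q<2$ and $2<\alpha<Q$. Then there exists a constant $C>0$ (depending on $Q,q,\alpha,\Omega$ but not on $\phi$) such that for every $\phi\in C_0^\infty(\Omega)$, $$\int_\Omega\rho^{\alpha}\frac{|\Delta_\gamma\phi|^2}{|\nabla_\gamma\rho|^2}\,dz\ \ge\ \Big(\frac{Q-\alpha}{2}\Big)^2\int_\Omega\rho^{\alpha}\frac{|\nabla_\gamma\phi|^2}{\rho^2}\,dz+\frac{C(Q-\alpha)(Q+3\alpha-8)}{4}\Big(\int_\Omega|\nabla_\gamma\phi|^q\rho^{\frac{q(\alpha-2)}{2}}\,dz\Big)^{2/q}.$$
   Context: Points of $\mathbb{R}^n$ are written $z=(x,y)$ with $x\in\mathbb{R}^m$, $y\in\mathbb{R}^k$, $m,k\ge1$, $n=m+k$, and $\gamma>0$. The Baouendi–Grushin gradient is $\nabla_\gamma=(\partial_{x_1},\dots,\partial_{x_m},|x|^\gamma\partial_{y_1},\dots,|x|^\gamma\partial_{y_k})$, and the Baouendi–Grushin operator is $\Delta_\gamma=\nabla_\gamma\cdot\nabla_\gamma=\Delta_x+|x|^{2\gamma}\Delta_y$. The homogeneous dimension is $Q=m+(1+\gamma)k$. The gauge is $\rho(z)=\big(|x|^{2(1+\gamma)}+(1+\gamma)^2|y|^2\big)^{\frac{1}{2(1+\gamma)}}$; one has $|\nabla_\gamma\rho|=|x|^\gamma/\rho^\gamma$. The integral on the left-hand side is allowed to be $+\infty$. *)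

(* Defs.v *)
From HB Require Import structures.
From mathcomp Require Import all_boot all_order all_algebra.
From mathcomp Require Import all_classical all_reals all_analysis.
Set Implicit Arguments. Unset Strict Implicit. Unset Printing Implicit Defensive.
Import Order.TTheory GRing.Theory Num.Theory.
Import numFieldNormedType.Exports.
Local Open Scope classical_set_scope.
Local Open Scope ring_scope.

Section Grushin.
Variable R : realType.

(* Euclidean norm on row vectors (MathComp's `|v| on matrices is the sup norm) *)
Definition enorm (n : nat) (v : 'rV[R]_n) : R := Num.sqrt (\sum_(i < n) v 0 i ^+ 2).

Definition ebase (n : nat) (i : 'I_n) : 'rV[R]_n := delta_mx 0 i.

Fixpoint iterD (n : nat) (ds : seq 'rV[R]_n) (f : 'rV[R]_n -> R) : 'rV[R]_n -> R :=
  match ds with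
  | [::] => f
  | d :: ds' => fun z => 'D_d (iterD ds' f) z
  end.

Definition smooth (n : nat) (f : 'rV[R]_n -> R) : Prop :=
  forall ds : seq 'rV[R]_n,
    continuous (iterD ds f) /\ forall (d z : 'rV[R]_n), derivable (iterD ds f) z d.

Definition bounded_domain (n : nat) (O : set 'rV[R]_n) : Prop :=
  open O /\ connected O /\ bounded_set O /\ O !=set0.

Definition smooth_boundary (n : nat) (O : set 'rV[R]_n) : Prop :=
  forall p : 'rV[R]_n, closure O p -> ~ O p ->
    exists (U : set 'rV[R]_n) (g : 'rV[R]_n -> R),
      [/\ open U, U p, smooth g,
          (forall z, U z -> exists i : 'I_n, 'D_(ebase i) g z != 0) &
          (forall z, U z -> (O z <-> g z < 0))].

Definition Cc_inf (n : nat) (O : set 'rV[R]_n) (phi : 'rV[R]_n -> R) : Prop :=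
  smooth phi /\ exists K : set 'rV[R]_n,
    [/\ compact K, K `<=` O & forall z, ~ K z -> phi z = 0].

(* Lebesgue integral of a [0,+oo]-valued function on R^n, as the iterated
   one-dimensional Lebesgue integral (equal to the n-dimensional one by Tonelli) *)
Fixpoint iint (n : nat) : ('rV[R]_n -> \bar R) -> \bar R :=
  match n with
  | 0 => fun f => f 0
  | n'.+1 => fun f =>
      (\int[lebesgue_measure]_(t in [set: R])
         iint (fun v : 'rV[R]_n' => f (row_mx (const_mx t : 'rV[R]_1) v)))%E
  end.

Definition int_over (n : nat) (O : set 'rV[R]_n) (f : 'rV[R]_n -> \bar R) : \bar R :=
  iint (fun z => if `[< O z >] then f z else 0%E).

Variables (m k : nat) (gamma : R).

Definition xpart (z : 'rV[R]_(m + k)) : 'rV[R]_m := lsubmx z.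
Definition ypart (z : 'rV[R]_(m + k)) : 'rV[R]_k := rsubmx z.

Definition dx (i : 'I_m) : 'rV[R]_(m + k) := ebase (lshift k i).
Definition dy (j : 'I_k) : 'rV[R]_(m + k) := ebase (rshift m j).

Definition grad_g (f : 'rV[R]_(m + k) -> R) (z : 'rV[R]_(m + k)) : 'rV[R]_(m + k) :=
  row_mx (\row_(i < m) 'D_(dx i) f z)
         (\row_(j < k) (enorm (xpart z) `^ gamma * 'D_(dy j) f z)).

Definition lap_g (f : 'rV[R]_(m + k) -> R) (z : 'rV[R]_(m + k)) : R :=
  \sum_(i < m) 'D_(dx i) ('D_(dx i) f) z
  + enorm (xpart z) `^ (2 * gamma) * \sum_(j < k) 'D_(dy j) ('D_(dy j) f) z.

Definition Qdim : R := m%:R + (1 + gamma) * k%:R.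

Definition rho (z : 'rV[R]_(m + k)) : R :=
  (enorm (xpart z) `^ (2 * (1 + gamma)) + (1 + gamma) ^+ 2 * enorm (ypart z) ^+ 2)
    `^ (1 / (2 * (1 + gamma))).

End Grushin.

(* Main.v *)
(** Put [p = 1 + gamma], [N = rho^(2p) = |x|^(2p) + p^2 |y|^2], [T = N + tau],
    [a = (alpha - 2)/(2p)] and [D = Delta_gamma phi].  Completing a square bounds the left-hand
    integrand [N^(a+1) D^2 / |x|^(2 gamma)] below by
    [- 2 s T^a phi D - s^2 |x|^(2 gamma) T^(a-1) phi^2], up to an error of order
    [tau^(min(a,1)/2)].  This bound minus
    [((Q - alpha)/2)^2 T^a |grad phi|^2 + c mu T^(a+ep) |grad phi|^2] is, pointwise, a divergence
    plus squares plus a nonnegative multiple of [phi^2]: the integration by parts behind the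
    Rellich inequality is merged with a Hardy inequality improved by the gain [T^ep].  The signs
    are right for every [tau > 0], so that no singular integral is ever estimated, and [N] is
    regular enough for each component of the field to be [C^1] in the direction in which it is
    differentiated.  Young's inequality bounds the [L^q] term by the gain, because
    [T^(-1/(4p)) <= |x_i|^(-1/2)] is integrable.  Only continuous functions on a cube are ever
    integrated, which avoids joint measurability for the iterated integral. *)
Require Import Defs.
From HB Require Import structures.
From mathcomp Require Import all_boot all_order all_algebra.
From mathcomp Require Import all_classical all_reals all_analysis.
From mathcomp Require Import measurable_realfun.
From mathcomp Require Import ring lra.
Set Implicit Arguments. Unset Strict Implicit. Unset Printing Implicit Defensive.
Import Order.TTheory GRing.Theory Num.Theory.
Import numFieldNormedType.Exports.
Local Open Scope classical_set_scope.
Local Open Scope ring_scope.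

(** * Iterated integrals of continuous functions over a cube *)

(** Put [t = (Q - alpha)/2], [d = alpha - 2] and [mu = t (t + 2 d)]. Formally, at [tau = 0],
    integration by parts turns [- 2 s T^a phi D] into [2 s T^a |grad phi|^2 - 2 s d (t + d) |x|^(2
    gamma) T^(a-1) phi^2]. The choice [s = t (t + d)] gives both [2 s = t^2 + mu] and
    [s^2 + 2 s d (t + d) = mu (t + d)^2]. So once [t^2 T^a |grad phi|^2] is set aside, exactly [mu]
    times the deficit of the sharp weighted Hardy inequality, with constant [(t + d)^2], is left.
    Nothing of leading order remains, and the gain has to come from Hardy itself: its slope [t + d]
    is perturbed to [t + d + b T^ep]. Differentiating [T^ep] yields a term of order [b ep T^ep],
    which pays for the new square [b^2 T^(2 ep)] and for giving up the fraction [c T^ep] of the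
    gradient, provided [b] and [c] are small against the maximum of [T^ep]; boundedness of the
    domain enters here. *)

Definition cons_row (R : realType) n (t : R) (v : 'rV[R]_n) : 'rV[R]_n.+1 :=
  row_mx (const_mx t : 'rV[R]_1) v.

Definition cube (R : realType) (M : R) n : set 'rV[R]_n :=
  [set v | forall i, `|v ord0 i| <= M].

Arguments cube {R} M n.

(** Follows the recursion of [iint] with real-valued integrals over a segment, so that the two agree
    slice by slice on continuous functions vanishing off the cube ([iint_boxint]). *)
Fixpoint boxint (R : realType) (M : R) n : ('rV[R]_n -> R) -> R :=
  match n with
  | 0 => fun f => f 0
  | n'.+1 => fun f =>
     \int[lebesgue_measure]_(t in `[- M, M])
        boxint M (fun v : 'rV[R]_n' => f (cons_row t v))
  end.

Section cons_row.
Variables (R : realType) (n : nat).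
Implicit Types (t : R) (v : 'rV[R]_n).

Lemma cons_row0 t v : cons_row t v ord0 ord0 = t.
Proof.
have -> : (@ord0 n) = lshift n (@ord0 0) :> 'I_n.+1 by exact/val_inj.
exact: (etrans (row_mxEl (const_mx t : 'rV_1) v ord0 ord0) (mxE _ _ _ _)).
Qed.

Lemma cons_rowS t v (j : 'I_n) : cons_row t v ord0 (lift ord0 j) = v ord0 j.
Proof.
rewrite -rshift1; exact: (row_mxEr (const_mx t : 'rV_1) v ord0 j).
Qed.

Lemma cons_rowP (P : 'I_n.+1 -> Prop) : P ord0 -> (forall j, P (lift ord0 j)) ->
  forall i, P i.
Proof. by move=> P0 PS i; case: (unliftP ord0 i) => [j ->|->]. Qed.

Lemma cube_cons M t v : cube M n.+1 (cons_row t v) <-> `|t| <= M /\ cube M n v.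
Proof.
split=> [c|[tM vM]].
  split; first by have := c ord0; rewrite cons_row0.
  by move=> j; have := c (lift ord0 j); rewrite cons_rowS.
by apply: cons_rowP => [|j]; rewrite ?cons_row0 ?cons_rowS.
Qed.

Lemma cons_row_continuous : continuous (fun tv : R * 'rV[R]_n => cons_row tv.1 tv.2).
Proof.
move=> [t v] A /nbhs_ballP[e e0 eA].
apply/nbhs_ballP; exists e => // -[t' v'] [/= tt' [_ vv']].
apply: eA; split => // i j; rewrite (ord1 i) {i}; move: j.
by apply: cons_rowP => [|j]; rewrite ?cons_row0 ?cons_rowS.
Qed.

Lemma cons_row_continuousr t : continuous (fun v => cons_row t v).
Proof.
move=> v; have cp : {for v, continuous (fun v => (t, v))}.
  exact: (@cvg_pair _ _ _ _ (nbhs t) (nbhs v) _ _ _ (cst t) id (cvg_cst _) cvg_id).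
exact: (continuous_comp cp (@cons_row_continuous (t, v))).
Qed.

Lemma cons_row_ebase0 t h v :
  cons_row t v + h *: ebase R (@ord0 n) = cons_row (t + h) v.
Proof.
apply/rowP; apply: cons_rowP => [|j]; rewrite [LHS]mxE ?cons_row0 ?cons_rowS.
  by rewrite !mxE eqxx mulr1.
by rewrite !mxE /= mulr0 addr0.
Qed.

Lemma cons_row_ebaseS t h v (j : 'I_n) :
  cons_row t v + h *: ebase R (lift ord0 j) = cons_row t (v + h *: ebase R j).
Proof.
apply/rowP; apply: cons_rowP => [|i]; rewrite [LHS]mxE ?cons_row0 ?cons_rowS.
  by rewrite !mxE /= mulr0 addr0.
by rewrite !mxE (inj_eq lift_inj).
Qed.

Lemma cube_compact (M : R) : compact (cube M n).
Proof.
have -> : cube M n = [set v : 'rV[R]_n | forall i, `[- M, M]%classic (v ord0 i)].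
  apply/seteqP; split => v vM i; have := vM i; rewrite /= in_itv /= ler_norml; done.
apply: (@rV_compact R n (fun=> `[- M, M]%classic)) => i.
exact: segment_compact.
Qed.

(** Tube argument: joint continuity gives a product neighbourhood of each [(t0, v)], and compactness
    of the cube makes the neighbourhood of [t0] uniform in [v]. *)
Lemma slice_unif_continuous (M : R) (f : 'rV[R]_n.+1 -> R) (t0 e : R) : continuous f -> 0 < e ->
  \forall t \near t0, forall v, cube M n v ->
    `|f (cons_row t v) - f (cons_row t0 v)| < e.
Proof.
move=> cf e0.
have := (compact_near_coveringP _).1 (@cube_compact M) R (nbhs t0)
  (fun t v => `|f (cons_row t v) - f (cons_row t0 v)| < e) _.
apply => v _.
have cfc : continuous (f \o (fun tv : R * 'rV[R]_n => cons_row tv.1 tv.2)).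
  by move=> tv; apply: continuous_comp; [exact: cons_row_continuous|exact: cf].
have e2 : 0 < e / 2 by rewrite divr_gt0.
have /cvgr_dist_lt/(_ _ e2)/nbhs_ballP[d /= d0 dP] := cfc (t0, v).
exists (ball v d, ball t0 d) => /=.
  by split; apply: nbhsx_ballx.
move=> [v' t] [/= v'v tt0].
have H1 := dP (t, v') (conj tt0 v'v).
have H2 := dP (t0, v') (conj (ballxx t0 d0) v'v).
rewrite /= in H1 H2.
rewrite (_ : e = e / 2 + e / 2); last by field.
rewrite (_ : _ - _ = (f (cons_row t0 v) - f (cons_row t0 v')) -
  (f (cons_row t0 v) - f (cons_row t v'))); last by ring.
by rewrite (le_lt_trans (ler_normB _ _))// ltrD.
Qed.

End cons_row.

Section integral1.
Variables (R : realType) (M : R).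
Hypothesis M0 : 0 < M.
Implicit Types f g : R -> R.
Let mu := @lebesgue_measure R.

Lemma itv_integrable f : continuous f -> mu.-integrable `[- M, M] (EFin \o f).
Proof.
move=> cf; apply: continuous_compact_integrable; first exact: segment_compact.
exact: continuous_subspaceT.
Qed.

Lemma Rintegral_itv_cst (c : R) : \int[mu]_(t in `[- M, M]) c = 2 * M * c.
Proof.
rewrite Rintegral_cst//= lebesgue_measure_itv /= lte_fin gtrN// -EFinB /=.
by rewrite opprK mulrC -mulr2n mulr_natl.
Qed.

Lemma Rintegral_itv_dist f g (e : R) : continuous f -> continuous g ->
  (forall t, `|t| <= M -> `|f t - g t| <= e) ->
  `|\int[mu]_(t in `[- M, M]) f t - \int[mu]_(t in `[- M, M]) g t| <= 2 * M * e.
Proof.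
move=> cf cg fg.
have fi := itv_integrable cf; have gi := itv_integrable cg.
have cfg : continuous (f \- g) by move=> x; apply: cvgB; [exact: cf|exact: cg].
rewrite -RintegralB// (le_trans (le_normr_Rintegral _ (itv_integrable cfg)))//.
rewrite -Rintegral_itv_cst; apply: le_Rintegral => //.
- apply: itv_integrable => x; apply: cvg_norm; exact: cfg.
- by apply: itv_integrable => x; exact: cvg_cst.
- by move=> t; rewrite /= in_itv /= -ler_norml; exact: fg.
Qed.

Lemma Rintegral_itv_FTC f g : continuous f -> (forall t : R, is_derive t 1 f (g t)) ->
  continuous g -> \int[mu]_(t in `[- M, M]) g t = f M - f (- M).
Proof.
move=> cf df cg; rewrite /Rintegral (@continuous_FTC2 _ g f)//.
- by rewrite gtrN.
- exact: continuous_subspaceT.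
- split; first by move=> x _; exact: (@ex_derive _ _ _ _ _ _ _ (df x)).
  + exact: cvg_at_right_filter (cf _).
  + exact: cvg_at_left_filter (cf _).
- by move=> x _; rewrite derive1E; exact: (@derive_val _ _ _ _ _ _ _ (df x)).
Qed.

End integral1.

Section boxint.
Variables (R : realType) (M : R).
Hypothesis M0 : 0 < M.
Let mu := @lebesgue_measure R.

Lemma slice_continuous n (f : 'rV[R]_n.+1 -> R) t : continuous f ->
  continuous (fun v => f (cons_row t v)).
Proof.
move=> cf v.
apply: (@continuous_comp _ _ _ (fun v => cons_row t v) f).
  exact: cons_row_continuousr.
exact: cf.
Qed.

(** Isolated as a predicate on [n] for the induction: contractivity in dimension [n] makes slice
    integrals continuous, hence integrable, and contractivity in dimension [n + 1] presupposes
    that. *)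
Definition boxint_contractive n := forall (f g : 'rV[R]_n -> R) e,
  continuous f -> continuous g -> (forall v, cube M n v -> `|f v - g v| <= e) ->
  `|boxint M f - boxint M g| <= (2 * M) ^+ n * e.

Lemma contractive_slice_continuous n (f : 'rV[R]_n.+1 -> R) : boxint_contractive n ->
  continuous f -> continuous (fun t => boxint M (fun v => f (cons_row t v))).
Proof.
move=> An cf t0; apply/cvgrPdist_le => /= e e0.
have d0 : 0 < e / (2 * M) ^+ n by rewrite divr_gt0// exprn_gt0// mulr_gt0.
apply: filterS (slice_unif_continuous M t0 cf d0) => t H.
rewrite distrC [leRHS](_ : _ = (2 * M) ^+ n * (e / (2 * M) ^+ n)); last first.
  by rewrite mulrCA divff ?mulr1// expf_neq0// mulf_neq0// gt_eqF.
by apply: An; [exact: slice_continuous|exact: slice_continuous|move=> v /H/ltW].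
Qed.

Lemma boxint_dist n : boxint_contractive n.
Proof.
elim: n => [|n IH] f g e cf cg fg /=.
  by rewrite expr0 mul1r; apply: fg => -[].
rewrite exprS -mulrA; apply: Rintegral_itv_dist => //.
- exact: contractive_slice_continuous.
- exact: contractive_slice_continuous.
move=> t tM; apply: IH; [exact: slice_continuous|exact: slice_continuous|].
by move=> v vM; apply: fg; apply/cube_cons.
Qed.

Lemma boxint_slice_continuous n (f : 'rV[R]_n.+1 -> R) :
  continuous f -> continuous (fun t => boxint M (fun v => f (cons_row t v))).
Proof. by apply: contractive_slice_continuous; exact: boxint_dist. Qed.

Lemma boxint_slice_integrable n (f : 'rV[R]_n.+1 -> R) : continuous f ->
  mu.-integrable `[- M, M] (EFin \o (fun t => boxint M (fun v => f (cons_row t v)))).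
Proof. by move=> cf; apply: itv_integrable; exact: boxint_slice_continuous. Qed.

Lemma boxintD n (f g : 'rV[R]_n -> R) : continuous f -> continuous g ->
  boxint M (fun v => f v + g v) = boxint M f + boxint M g.
Proof.
elim: n f g => [|n IH] f g cf cg //=.
rewrite -RintegralD//; [|exact: boxint_slice_integrable..].
by apply: eq_Rintegral => t _; apply: IH; exact: slice_continuous.
Qed.

Lemma boxintZ n (f : 'rV[R]_n -> R) c : continuous f ->
  boxint M (fun v => c * f v) = c * boxint M f.
Proof.
elim: n f => [|n IH] f cf //=.
rewrite -RintegralZl//; last exact: boxint_slice_integrable.
by apply: eq_Rintegral => t _; apply: IH; exact: slice_continuous.
Qed.

Lemma le_boxint n (f g : 'rV[R]_n -> R) : continuous f -> continuous g ->
  (forall v, cube M n v -> f v <= g v) -> boxint M f <= boxint M g.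
Proof.
elim: n f g => [|n IH] f g cf cg fg /=; first by apply: fg => -[].
apply: le_Rintegral => //; [exact: boxint_slice_integrable..|].
move=> t; rewrite /= in_itv /= -ler_norml => tM.
apply: IH; [exact: slice_continuous|exact: slice_continuous|].
by move=> v vM; apply: fg; apply/cube_cons.
Qed.

Lemma boxint_cst n c : boxint M (fun _ : 'rV[R]_n => c) = (2 * M) ^+ n * c.
Proof.
elim: n => [|n IH] /=; first by rewrite expr0 mul1r.
by under eq_Rintegral do rewrite IH; rewrite Rintegral_itv_cst// mulrA exprS.
Qed.

End boxint.

Section derive_aux.
Variables (R : realType) (V : normedModType R).

Lemma is_deriveP (a v : V) (f : V -> R) (df : R) :
  (h^-1 *: (f (h *: v + a) - f a)) @[h --> 0^'] --> df <-> is_derive a v f df.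
Proof.
split=> [H|[d <-]]; last by [].
by apply: DeriveDef; [apply/cvg_ex; exists df|apply/cvg_lim].
Qed.

Lemma MVT_sym (f df : R -> R) (a b : R) : (forall x : R, is_derive x 1 f (df x)) ->
  exists2 c, `|c - a| <= `|b - a| & f b - f a = df c * (b - a).
Proof.
move=> fd.
have cf : continuous f.
  move=> x; apply: differentiable_continuous; apply/derivable1_diffP.
  exact: (@ex_derive _ _ _ _ _ _ _ (fd x)).
have [ab|/ltW ba] := leP a b.
  have [c] := @MVT_segment R f df a b ab (fun x _ => fd x) (continuous_subspaceT cf).
  rewrite in_itv /= => /andP[ac cb] ->; exists c => //.
  by rewrite !ger0_norm ?subr_ge0// lerD2r.
have [c] := @MVT_segment R f df b a ba (fun x _ => fd x) (continuous_subspaceT cf).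
rewrite in_itv /= => /andP[bc ca] E; exists c.
  by rewrite !ler0_norm ?subr_le0// lerN2 lerD2r.
by rewrite -opprB E -mulrN opprB.
Qed.

End derive_aux.

Section boxint_derive.
Variables (R : realType) (M : R).
Hypothesis M0 : 0 < M.

Lemma is_derive_slice0 n (F : 'rV[R]_n.+1 -> R) d t v :
  is_derive (cons_row t v) (ebase R ord0) F d ->
  is_derive (t : R) 1 (fun s : R => F (cons_row s v)) d.
Proof.
move/is_deriveP => H; apply/is_deriveP; move: H.
set f1 := (X in X @ _ --> _); set f2 := (X in _ -> X @ _ --> _).
suff -> : f1 = f2 by [].
apply/funext => h; congr (_ *: (F _ - _)).
by rewrite addrC cons_row_ebase0 [h *: 1]mulr1 addrC.
Qed.

Lemma is_derive_sliceS n (F : 'rV[R]_n.+1 -> R) d t v (j : 'I_n) :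
  is_derive (cons_row t v) (ebase R (lift ord0 j)) F d ->
  is_derive v (ebase R j) (fun w => F (cons_row t w)) d.
Proof.
move/is_deriveP => H; apply/is_deriveP; move: H.
set f1 := (X in X @ _ --> _); set f2 := (X in _ -> X @ _ --> _).
suff -> : f1 = f2 by [].
apply/funext => h; congr (_ *: (F _ - _)).
by rewrite addrC cons_row_ebaseS addrC.
Qed.

(** Differentiation under the integral sign: by the mean value theorem each difference quotient is a
    value of [G] on a nearby slice, and [slice_unif_continuous] makes the error uniform in [v]. *)
Lemma is_derive_boxint n (F G : 'rV[R]_n.+1 -> R) (t : R) :
  continuous F -> continuous G ->
  (forall z, is_derive z (ebase R ord0) F (G z)) ->
  is_derive t 1 (fun s => boxint M (fun v => F (cons_row s v)))
    (boxint M (fun v => G (cons_row t v))).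
Proof.
move=> cF cG dF; apply/is_deriveP/cvgrPdist_le => /= e e0.
have L0 : 0 < (2 * M) ^+ n by rewrite exprn_gt0// mulr_gt0.
have d0 : 0 < e / (2 * M) ^+ n by rewrite divr_gt0.
have /nbhs_ballP[r /= r0 rP] := slice_unif_continuous M t cG d0.
apply/nbhs_ballP; exists r => //= h; rewrite /ball /= sub0r normrN => hr h0.
have cFt s : continuous (fun v => F (cons_row s v)) by exact: slice_continuous.
have cGt : continuous (fun v => G (cons_row t v)) by exact: slice_continuous.
have chG : continuous (fun v => h * G (cons_row t v)).
  by move=> v; apply: (@cvgM R _ (nbhs v)); [exact: cvg_cst|exact: cGt].
rewrite [h *: 1]mulr1 [h + t]addrC.
rewrite -(ler_pM2l (_ : 0 < `|h|)) ?normr_gt0// -normrM mulrBr.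
rewrite [h * (_ *: _)]mulrA divff// mul1r -boxintZ// opprB addrCA addrA -boxintD//.
rewrite distrC (_ : `|h| * e = (2 * M) ^+ n * (`|h| * (e / (2 * M) ^+ n))); last first.
  by rewrite mulrCA [_ ^+ n * _]mulrCA divff ?mulr1// gt_eqF.
apply: boxint_dist => //.
  by move=> v; apply: (@cvgD _ _ _ (nbhs v)); [exact: (cFt t v)|exact: (chG v)].
move=> v vM.
have [c ct E] := @MVT_sym R (fun s => F (cons_row s v)) (fun s => G (cons_row s v))
  t (t + h) (fun s => is_derive_slice0 (dF _)).
rewrite [_ + h * _]addrC opprD addrA addrAC E (addrC t) addrK mulrC -mulrBr normrM.
rewrite ler_pM2l ?normr_gt0//; apply/ltW/rP => //.
by rewrite /ball /= distrC (le_lt_trans ct)// (addrC t) addrK.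
Qed.

Lemma boxint0_le n (F : 'rV[R]_n -> R) K : continuous F ->
  (forall z, cube M n z -> `|F z| <= K) -> `|boxint M F| <= (2 * M) ^+ n * K.
Proof.
move=> cF FK; have /= := boxint_dist M0 cF (fun v => @cvg_cst _ (0 : R) _ (nbhs v) _).
rewrite boxint_cst// mulr0 subr0; apply => v /FK; by rewrite subr0.
Qed.

(** One component of the divergence theorem: only the two faces orthogonal to the [i]-th axis
    contribute. The first coordinate is settled by the fundamental theorem of calculus for slice
    integrals, the others by induction on slices, so the order of integration is never changed. It
    serves with [K = 0] for the field and with [K = M] for the negative power of the gauge. *)
Lemma boxint_derive_le n (i : 'I_n) (F G : 'rV[R]_n -> R) K :
  continuous F -> continuous G ->
  (forall z, is_derive z (ebase R i) F (G z)) ->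
  (forall z, cube M n z -> `|z ord0 i| = M -> `|F z| <= K) ->
  `|boxint M G| <= (2 * M) ^+ n.-1 * (2 * K).
Proof.
elim: n i F G => [[]//|n IH] i F G cF cG dF FK.
case: (unliftP ord0 i) => [j ij|i0].
  rewrite ij in dF FK; case: n j IH F G cF cG dF FK {i ij} => [[]//|n] j IH F G cF cG dF FK.
  have -> : (2 * M) ^+ n.+2.-1 * (2 * K) = 2 * M * ((2 * M) ^+ n.+1.-1 * (2 * K)).
    by rewrite /= exprS mulrA.
  rewrite -[boxint M G]subr0 -(mulr0 (2 * M)) -[X in _ - X](Rintegral_itv_cst M0).
  apply: Rintegral_itv_dist => //.
  - exact: (boxint_slice_continuous M0 cG).
  - by move=> t; exact: cvg_cst.
  move=> t tM; rewrite subr0. 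
  apply: (IH j (fun v => F (cons_row t v)) (fun v => G (cons_row t v))).
  - exact: slice_continuous.
  - exact: slice_continuous.
  - by move=> z; exact: is_derive_sliceS.
  - by move=> z zM zj; apply: FK; [exact/cube_cons|rewrite cons_rowS].
rewrite i0 in dF FK; rewrite /=.
pose g s := boxint M (fun v => F (cons_row s v)).
rewrite (_ : Rintegral _ _ _ = g M - g (- M)); last first.
  apply: Rintegral_itv_FTC => //; first exact: boxint_slice_continuous.
    by move=> t; exact: is_derive_boxint.
  exact: boxint_slice_continuous.
rewrite mulrCA mulrDl mul1r (le_trans (ler_normB _ _))//.
have face s : `|s| = M -> `|g s| <= (2 * M) ^+ n * K.
  move=> sM; apply: boxint0_le; first exact: slice_continuous.
  by move=> v vM; apply: FK; [apply/cube_cons; rewrite sM|rewrite cons_row0].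
by apply: lerD; apply: face; rewrite ?normrN gtr0_norm.
Qed.

End boxint_derive.

(** * Comparison of the extended iterated integral with the integral over the cube *)

Section iint.
Variable R : realType.
Let mu := @lebesgue_measure R.
Local Open Scope ereal_scope.

(** The integral of a nonnegative function is a supremum over the simple functions below it, so
    monotonicity holds without measurability of either side. *)
Lemma ge0_le_integralT (f g : R -> \bar R) : (forall x, 0 <= f x) ->
  (forall x, f x <= g x) -> \int[mu]_x f x <= \int[mu]_x g x.
Proof.
move=> f0 fg; rewrite !ge0_integralTE//; last by move=> x; exact: le_trans (fg x).
by apply: le_ereal_sup => _ [h hf <-]; exists h => // x; exact: le_trans (fg x).
Qed.

Lemma iint_ge0 n (f : 'rV[R]_n -> \bar R) : (forall z, 0 <= f z) -> 0 <= iint f.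
Proof. by elim: n f => [|n IH] f f0 //=; apply: integral_ge0 => t _; exact: IH. Qed.

Lemma le_iint n (f g : 'rV[R]_n -> \bar R) : (forall z, 0 <= f z) ->
  (forall z, f z <= g z) -> iint f <= iint g.
Proof.
elim: n f g => [|n IH] f g f0 fg //=; apply: ge0_le_integralT => t.
  exact: iint_ge0.
exact: IH.
Qed.

Variable M : R.
Hypothesis M0 : (0 < M)%R.

Lemma integral_supp_itv (g : R -> R) : continuous g ->
  (forall t, (M < `|t|)%R -> g t = 0%R) ->
  \int[mu]_t (g t)%:E = (\int[mu]_(t in `[(- M)%R, M]) g t)%:E.
Proof.
move=> cg g0; rewrite /Rintegral fineK; last first.
  by apply: integrable_fin_num => //; exact: itv_integrable.
rewrite [RHS]integral_mkcond; apply: eq_integral => t _.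
rewrite patchE; case: ifPn => // /negP tM; rewrite g0// ltNge; apply/negP => tM'.
by apply: tM; rewrite inE /= in_itv /= -ler_norml.
Qed.

Lemma boxint_slice_supp n (f : 'rV[R]_n.+1 -> R) t :
  (forall z, ~ cube M n.+1 z -> f z = 0%R) -> (M < `|t|)%R ->
  boxint M (fun v => f (cons_row t v)) = 0%R.
Proof.
move=> f0 tM; have -> : (fun v => f (cons_row t v)) = (fun=> 0%R).
  by apply/funext => v; apply: f0 => /cube_cons[tM' _]; rewrite ltNge tM' in tM.
by rewrite boxint_cst// mulr0.
Qed.

Lemma iint_boxint n (f : 'rV[R]_n -> R) : continuous f ->
  (forall z, ~ cube M n z -> f z = 0%R) -> iint (EFin \o f) = (boxint M f)%:E.
Proof.
elim: n f => [|n IH] f cf f0 //=.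
rewrite -integral_supp_itv.
- apply: eq_integral => t _; rewrite -IH//; first exact: slice_continuous.
  by move=> v vM; apply: f0 => /cube_cons[].
- exact: boxint_slice_continuous.
- by move=> t; exact: boxint_slice_supp.
Qed.

(** The bound is asked only where the first coordinate is nonzero: the rest is a null set for the
    outermost integral, and there the left-hand integrand of the theorem may be a division by zero.
    Measurability is used for the slice integrals of the continuous [g] alone. *)
Lemma le_boxint_iint n (g : 'rV[R]_n.+1 -> R) (f : 'rV[R]_n.+1 -> \bar R) :
  continuous g -> (forall z, (0 <= g z)%R) -> (forall z, ~ cube M n.+1 z -> g z = 0%R) ->
  (forall z, 0 <= f z) -> (forall z : 'rV[R]_n.+1, z ord0 ord0 != 0%R -> (g z)%:E <= f z) ->
  (boxint M g)%:E <= iint f.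
Proof.
move=> cg g0 gM f0 gf /=.
have gE t : (boxint M (fun v => g (cons_row t v)))%:E = iint (fun v => (g (cons_row t v))%:E).
  rewrite -iint_boxint//; first exact: slice_continuous.
  by move=> v vM; apply: gM => /cube_cons[].
rewrite -integral_supp_itv; [|exact: boxint_slice_continuous
  |by move=> t; exact: boxint_slice_supp].
have mg := continuous_measurable_fun (boxint_slice_continuous M0 cg).
have mD : measurable ([set: R] `\ 0%R) by apply: measurableD => //; exact: measurable_set1.
have mg0 : measurable_fun ([set: R] `\ 0%R)
    (EFin \o (fun t => boxint M (fun v => g (cons_row t v)))).
  apply/measurable_EFinP.
  exact: (measurable_funS measurableT (@subsetT _ _) mg).
apply: le_trans (_ : \int[mu]_(t in [set: R] `\ 0%R)
    (boxint M (fun v => g (cons_row t v)))%:E <= _).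
  by rewrite (integral_setD1 mD mg0).
rewrite integral_mkcond; apply: ge0_le_integralT => t; rewrite patchE; case: ifPn => //.
- by move=> _; rewrite gE; apply: iint_ge0 => v; rewrite lee_fin.
- rewrite inE /= => -[_ /eqP t0]; rewrite gE; apply: le_iint => v; first by rewrite lee_fin.
  by apply: gf; rewrite cons_row0.
- by move=> _; apply: iint_ge0 => v; exact: f0.
Qed.

End iint.

(** * Directional derivatives *)

Section derive_rules.
Variables (R : realType) (V : normedModType R).

Lemma is_derive_line (z v : V) (f : V -> R) d :
  is_derive z v f d <-> is_derive (0 : R) 1 (fun s : R => f (s *: v + z)) d.
Proof.
split=> /is_deriveP H; apply/is_deriveP; move: H.
  set f1 := (X in X @ _ --> _); set f2 := (X in _ -> X @ _ --> _).
  suff -> : f1 = f2 by [].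
  by apply/funext => h; rewrite /f1 /f2 /= addr0 scale0r add0r [h *: 1]mulr1.
set f1 := (X in X @ _ --> _); set f2 := (X in _ -> X @ _ --> _).
suff -> : f1 = f2 by [].
by apply/funext => h; rewrite /f1 /f2 /= addr0 scale0r add0r [h *: 1]mulr1.
Qed.

Lemma is_derive_comp_real (z v : V) (f : V -> R) (g : R -> R) df dg :
  is_derive z v f df -> is_derive (f z) 1 g dg ->
  is_derive z v (fun x => g (f x)) (dg * df).
Proof.
move=> /is_derive_line fd gd; apply/is_derive_line.
have gd' : is_derive (f ((0 : R) *: v + z)) 1 g dg by rewrite scale0r add0r.
exact: (@is_derive1_comp _ g (fun s : R => f (s *: v + z)) 0 _ _ gd' fd).
Qed.

Lemma is_derive_powR (z v : V) (f : V -> R) df r : 0 < f z ->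
  is_derive z v f df -> is_derive z v (fun x => f x `^ r) (r * f z `^ (r - 1) * df).
Proof.
move=> f0 fd; apply: (is_derive_comp_real (g := fun y => y `^ r)) => //.
exact: is_derive1_powR.
Qed.

(* [f] need not be differentiable at [z]; covers [|x|^(2 gamma) x_i] where [x = 0]. *)
Lemma is_derive_mul0 (z v : V) (f g : V -> R) dg : {for z, continuous f} ->
  g z = 0 -> is_derive z v g dg -> is_derive z v (fun x => f x * g x) (f z * dg).
Proof.
move=> cf g0 /is_deriveP gd; apply/is_deriveP.
have -> : (fun h : R => h^-1 *: (f (h *: v + z) * g (h *: v + z) - f z * g z)) =
  (fun h : R => f (h *: v + z) * (h^-1 *: (g (h *: v + z) - g z))).
  by apply/funext => h; rewrite g0 mulr0 !subr0 scalerAr.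
apply: cvgM gd.
have c0 : {for (0 : R), continuous (fun h : R => h *: v + z)}.
  apply: (@cvgD _ _ _ (nbhs (0 : R)) _ (fun h : R => h *: v) (cst z)).
    exact: scalel_continuous.
  exact: cvg_cst.
have cf0 : {for (0 : R) *: v + z, continuous f} by rewrite scale0r add0r.
have : f (h *: v + z) @[h --> (0 : R)] --> f z.
  have {2}-> : z = (0 : R) *: v + z by rewrite scale0r add0r.
  exact: (@continuous_comp _ _ _ (fun h : R => h *: v + z) f 0 c0 cf0).
exact: cvg_within_filter.
Qed.

End derive_rules.

Section powR_continuity.
Variables (R : realType) (T : topologicalType).

Lemma powR_continuousP (f : T -> R) r : continuous f -> (forall z, 0 < f z) ->
  continuous (fun z => f z `^ r).
Proof.
move=> cf f0 z.
have : {for f z, continuous (fun y : R => y `^ r)}.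
  apply: differentiable_continuous; apply/derivable1_diffP.
  exact: (@ex_derive _ _ _ _ _ _ _ (is_derive1_powR r (f0 z))).
exact: (@continuous_comp _ _ _ f (fun y : R => y `^ r) z (cf z)).
Qed.

Lemma powR_continuous (f : T -> R) r : 0 < r -> continuous f -> (forall z, 0 <= f z) ->
  continuous (fun z => f z `^ r).
Proof.
move=> r0 cf f0 z; have := f0 z; rewrite le_eqVlt => /predU1P[fz|fz].
  apply/cvgrPdist_lt => /= e e0; rewrite -fz.
  have e1 : 0 < e `^ r^-1 by exact: powR_gt0.
  have /cvgrPdist_lt/(_ _ e1) := cf z; rewrite -fz => H.
  apply: filterS H => w; rewrite !sub0r normrN (ger0_norm (f0 w)) => H.
  rewrite powR0 ?gt_eqF// sub0r normrN ger0_norm ?powR_ge0//.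
  rewrite -[ltRHS]powRr1 ?ltW// -(@mulVf _ r) ?gt_eqF// powRrM.
  by apply: gt0_ltr_powR => //; rewrite nnegrE ?f0 ?powR_ge0.
have : {for f z, continuous (fun y : R => y `^ r)}.
  apply: differentiable_continuous; apply/derivable1_diffP.
  exact: (@ex_derive _ _ _ _ _ _ _ (is_derive1_powR r fz)).
exact: (@continuous_comp _ _ _ f (fun y : R => y `^ r) z (cf z)).
Qed.

Lemma continuousD_fun (f g : T -> R) : continuous f -> continuous g ->
  continuous (fun z => f z + g z).
Proof. by move=> cf cg z; apply: cvgD; [exact: cf|exact: cg]. Qed.

Lemma continuousM_fun (f g : T -> R) : continuous f -> continuous g ->
  continuous (fun z => f z * g z).
Proof. by move=> cf cg z; apply: cvgM; [exact: cf|exact: cg]. Qed.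

Lemma continuousX_fun (f : T -> R) n : continuous f ->
  continuous (fun z => f z ^+ n).
Proof.
move=> cf; elim: n => [|n IH].
  by under eq_fun do rewrite expr0; move=> z; exact: cvg_cst.
by under eq_fun do rewrite exprS; exact: continuousM_fun.
Qed.

Lemma continuous_sum_fun n (f : 'I_n -> T -> R) : (forall i, continuous (f i)) ->
  continuous (fun z => \sum_(i < n) f i z).
Proof.
elim: n f => [|n IH] f cf.
  by under eq_fun do rewrite big_ord0; move=> z; exact: cvg_cst.
by under eq_fun do rewrite big_ord_recl; apply: continuousD_fun => //; exact: IH.
Qed.

End powR_continuity.

(** Differentiability is asked in the single direction [e], continuity in all variables. This suits
    the fields below: [|x|^(2 gamma)] is a factor of their [y]-components and may fail to be
    differentiable in [x], but those components are only differentiated in [y]. *)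
Definition C1_along (R : realType) (V : normedModType R) (e : V) (F G : V -> R) : Prop :=
  [/\ continuous F, continuous G & forall z, is_derive z e F (G z)].

Section C1_along.
Variables (R : realType) (V : normedModType R) (e : V).

Lemma C1_alongD F G F' G' : C1_along e F G -> C1_along e F' G' ->
  C1_along e (fun z => F z + F' z) (fun z => G z + G' z).
Proof.
move=> [cF cG dF] [cF' cG' dF']; split; [exact: continuousD_fun..|].
by move=> z; exact: is_deriveD.
Qed.

Lemma C1_alongM F G F' G' : C1_along e F G -> C1_along e F' G' ->
  C1_along e (fun z => F z * F' z) (fun z => F z * G' z + F' z * G z).
Proof.
move=> [cF cG dF] [cF' cG' dF']; split.
- exact: continuousM_fun.
- by apply: continuousD_fun; exact: continuousM_fun.
- by move=> z; exact: is_deriveM.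
Qed.

Lemma C1_along_cst c : C1_along e (fun=> c) (fun=> 0).
Proof. by split=> z; [exact: cvg_cst|exact: cvg_cst|exact: is_derive_cst]. Qed.

Lemma C1_alongZ c F G : C1_along e F G ->
  C1_along e (fun z => c * F z) (fun z => c * G z).
Proof.
move=> [cF cG dF]; split=> [||z].
- by apply: continuousM_fun => // z; exact: cvg_cst.
- by apply: continuousM_fun => // z; exact: cvg_cst.
- exact: is_deriveZ.
Qed.

Lemma C1_along_sum n (F G : 'I_n -> V -> R) :
  (forall i, C1_along e (F i) (G i)) ->
  C1_along e (fun z => \sum_(i < n) F i z) (fun z => \sum_(i < n) G i z).
Proof.
elim: n F G => [|n IH] F G FG.
  under eq_fun do rewrite big_ord0; under [X in C1_along _ _ X]eq_fun do rewrite big_ord0.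
  exact: C1_along_cst.
under eq_fun do rewrite big_ord_recl.
under [X in C1_along _ _ X]eq_fun do rewrite big_ord_recl.
by apply: C1_alongD => //; exact: IH.
Qed.

Lemma C1_along_powR F G r : (forall z, 0 < F z) -> C1_along e F G ->
  C1_along e (fun z => F z `^ r) (fun z => r * F z `^ (r - 1) * G z).
Proof.
move=> F0 [cF cG dF]; split.
- exact: powR_continuousP.
- apply: continuousM_fun => //; apply: continuousM_fun; last exact: powR_continuousP.
  by move=> z; exact: cvg_cst.
- by move=> z; exact: is_derive_powR.
Qed.

Lemma C1_along_eq F G F' G' : F =1 F' -> G =1 G' ->
  C1_along e F G -> C1_along e F' G'.
Proof. by move=> /funext -> /funext ->. Qed.

End C1_along.

(** * The gauge and the Grushin gradient *)

Section grushin_geometry.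
Variables (R : realType) (m k : nat) (gamma : R).
Hypothesis gamma0 : 0 < gamma.
Local Notation V := 'rV[R]_(m + k).
Implicit Types (z : V) (i : 'I_m) (j : 'I_k).

Definition xc i z : R := z ord0 (lshift k i).
Definition yc j z : R := z ord0 (rshift m j).
Definition xsq z : R := \sum_(i < m) xc i z ^+ 2.
Definition ysq z : R := \sum_(j < k) yc j z ^+ 2.
(* [xwt] is [|x|^(2 gamma)] and [gau] is [rho^(2 (1 + gamma))]. *)
Definition xwt z : R := xsq z `^ gamma.
Definition gau z : R := xwt z * xsq z + (1 + gamma) ^+ 2 * ysq z.

Lemma C1_along_coord (e : V) l : C1_along e (fun z : V => z ord0 l) (fun=> e ord0 l).
Proof.
split=> [||z]; first exact: coord_continuous.
  exact: cst_continuous.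
apply/is_deriveP; apply: cvg_near_cst; near=> h.
rewrite !mxE addrK [h^-1 *: _]mulrA mulVf ?mul1r//.
by near: h; exact: nbhs_dnbhs_neq.
Unshelve. all: by end_near. Qed.

Lemma xc_dx i i' : xc i (@dx R m k i') = (i == i')%:R.
Proof. by rewrite /xc /dx /ebase mxE eqxx /= (inj_eq (@lshift_inj _ _)). Qed.

Lemma xc_dy i j : xc i (@dy R m k j) = 0.
Proof. by rewrite /xc /dy /ebase mxE eqxx /= eq_lrshift. Qed.

Lemma yc_dx i j : yc j (@dx R m k i) = 0.
Proof. by rewrite /yc /dx /ebase mxE eqxx /= eq_rlshift. Qed.

Lemma yc_dy j j' : yc j (@dy R m k j') = (j == j')%:R.
Proof. by rewrite /yc /dy /ebase mxE eqxx /= (inj_eq (@rshift_inj _ _)). Qed.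

Lemma C1_along_sumsq n (e : V) (c : 'I_n -> 'I_(m + k)) :
  C1_along e (fun z : V => \sum_(l < n) z ord0 (c l) ^+ 2)
    (fun z => \sum_(l < n) 2 * (z ord0 (c l) * e ord0 (c l))).
Proof.
apply: C1_along_sum => l; have H := C1_along_coord e (c l).
by apply: C1_along_eq (C1_alongM H H) => z; rewrite ?expr2//; ring.
Qed.

Lemma xsq_dx i : C1_along (@dx R m k i) xsq (fun z => 2 * xc i z).
Proof.
apply: C1_along_eq (C1_along_sumsq _ (@lshift m k)) => // z.
rewrite (bigD1 i)//= big1 ?addr0.
  by rewrite -/(xc i (dx _ _ i)) xc_dx eqxx mulr1.
by move=> l li; rewrite -/(xc l (dx _ _ i)) xc_dx (negbTE li) !mulr0.
Qed.

Lemma xsq_dy j : C1_along (@dy R m k j) xsq (fun=> 0).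
Proof.
apply: C1_along_eq (C1_along_sumsq _ (@lshift m k)) => // z.
by rewrite big1// => l _; rewrite -/(xc l (dy _ _ j)) xc_dy !mulr0.
Qed.

Lemma ysq_dx i : C1_along (@dx R m k i) ysq (fun=> 0).
Proof.
apply: C1_along_eq (C1_along_sumsq _ (@rshift m k)) => // z.
by rewrite big1// => l _; rewrite -/(yc l (dx _ _ i)) yc_dx !mulr0.
Qed.

Lemma ysq_dy j : C1_along (@dy R m k j) ysq (fun z => 2 * yc j z).
Proof.
apply: C1_along_eq (C1_along_sumsq _ (@rshift m k)) => // z.
rewrite (bigD1 j)//= big1 ?addr0.
  by rewrite -/(yc j (dy _ _ j)) yc_dy eqxx mulr1.
by move=> l lj; rewrite -/(yc l (dy _ _ j)) yc_dy (negbTE lj) !mulr0.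
Qed.

Lemma xsq_ge0 z : 0 <= xsq z.
Proof. by apply: sumr_ge0 => i _; exact: sqr_ge0. Qed.

Lemma ysq_ge0 z : 0 <= ysq z.
Proof. by apply: sumr_ge0 => i _; exact: sqr_ge0. Qed.

Lemma xwt_ge0 z : 0 <= xwt z.
Proof. exact: powR_ge0. Qed.

Lemma gau_ge0 z : 0 <= gau z.
Proof. by rewrite addr_ge0// mulr_ge0 ?xwt_ge0 ?xsq_ge0 ?ysq_ge0 ?sqr_ge0. Qed.

Lemma sqr_xc_le i z : xc i z ^+ 2 <= xsq z.
Proof.
by rewrite /xsq (bigD1 i)//= lerDl; apply: sumr_ge0 => l _; exact: sqr_ge0.
Qed.

Lemma xsq_continuous : continuous xsq.
Proof.
by apply: continuous_sum_fun => i; apply: continuousX_fun => z; exact: coord_continuous.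
Qed.

Lemma xwt_continuous : continuous xwt.
Proof. by apply: powR_continuous => //; [exact: xsq_continuous|exact: xsq_ge0]. Qed.

Lemma xwt_xsq0 z : xsq z = 0 -> xwt z = 0.
Proof. by move=> x0; rewrite /xwt x0 powR0// gt_eqF. Qed.

Lemma xwt_dy j : C1_along (@dy R m k j) xwt (fun=> 0).
Proof.
split=> [||z]; [exact: xwt_continuous|exact: cst_continuous|].
apply/is_deriveP; apply: cvg_near_cst; near=> h.
rewrite /xwt (_ : xsq (h *: dy _ _ j + z) = xsq z) ?subrr ?scaler0//.
apply: eq_bigr => i _; congr (_ ^+ 2).
by rewrite /xc !mxE eqxx /= eq_lrshift mulr0 add0r.
Unshelve. all: by end_near. Qed.

(* [x_i^2 |x|^(2 gamma - 2)]; the division yields the continuous extension [0] at [x = 0]. *)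
Definition xwt2 i z : R := xwt z * xc i z ^+ 2 / xsq z.

Lemma sum_xwt2 z : \sum_(i < m) xwt2 i z = xwt z.
Proof.
rewrite -mulr_suml -mulr_sumr -/(xsq z).
have [x0|x0] := eqVneq (xsq z) 0; first by rewrite xwt_xsq0// !mul0r.
by rewrite mulfK.
Qed.

Lemma xwt2_ge0 i z : 0 <= xwt2 i z.
Proof. by rewrite divr_ge0 ?xsq_ge0// mulr_ge0 ?xwt_ge0 ?sqr_ge0. Qed.

Lemma xwt2_le i z : xwt2 i z <= xwt z.
Proof.
rewrite -(sum_xwt2 z) (bigD1 i)//= lerDl; apply: sumr_ge0 => l _; exact: xwt2_ge0.
Qed.

(** Where [x = 0], continuity follows by squeezing between [0] and [xwt], which is continuous and
    vanishes there. *)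
Lemma xwt2_continuous i : continuous (xwt2 i).
Proof.
have cn : continuous (fun z => xwt z * xc i z ^+ 2).
  apply: continuousM_fun; first exact: xwt_continuous.
  by apply: continuousX_fun => z; exact: coord_continuous.
move=> z; have [x0|x0] := eqVneq (xsq z) 0; last first.
  apply: (@cvgM _ _ (nbhs z) _ (fun z => xwt z * xc i z ^+ 2) (fun z => (xsq z)^-1)).
    exact: cn.
  by apply: cvgV => //; exact: xsq_continuous.
have z2 : xwt2 i z = 0 by rewrite /xwt2 xwt_xsq0// !mul0r.
apply/(@cvgrPdist_lt _ _ _ (nbhs z)) => e e0; rewrite z2.
have /cvgrPdist_lt/(_ _ e0) := @xwt_continuous z; rewrite xwt_xsq0// => H.
apply: (@filterS _ (nbhs z) _ _ _ _ H) => w.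
rewrite !sub0r !normrN.
by rewrite !ger0_norm ?xwt_ge0 ?xwt2_ge0//; apply: le_lt_trans; exact: xwt2_le.
Qed.

Lemma xwt_is_derive i z : 0 < xsq z ->
  is_derive z (@dx R m k i) xwt (gamma * xsq z `^ (gamma - 1) * (2 * xc i z)).
Proof. by move=> x0; apply: is_derive_powR => //; have [_ _] := xsq_dx i; apply. Qed.

Lemma xwtB1 z : 0 < xsq z -> xsq z `^ (gamma - 1) = xwt z / xsq z.
Proof. 
move=> x0; rewrite powRB; first by rewrite powRr1// ltW.
by rewrite (gt_eqF x0) implybT.
Qed.

(** For [gamma <= 1/2] the factor [xwt] is not differentiable in [x] at [x = 0]; the vanishing of
    [xc i] there lets [is_derive_mul0] replace the product rule. *)
Lemma xwt_xc_dx i : C1_along (@dx R m k i) (fun z => xwt z * xc i z)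
  (fun z => xwt z + 2 * gamma * xwt2 i z).
Proof.
have cx : continuous (xc i) by move=> z; exact: coord_continuous.
split=> [||z].
- by apply: continuousM_fun; [exact: xwt_continuous|].
- apply: continuousD_fun; first exact: xwt_continuous.
  by apply: continuousM_fun; [exact: cst_continuous|exact: xwt2_continuous].
have xd : is_derive z (@dx R m k i) (xc i) 1.
  by have [_ _ /(_ z)] := C1_along_coord (@dx R m k i) (lshift k i);
    rewrite -/(xc i (dx _ _ i)) xc_dx eqxx.
have := xsq_ge0 z; rewrite le_eqVlt => /predU1P[/esym x0|x0].
  have xi0 : xc i z = 0.
    by apply/eqP; rewrite -sqrf_eq0 eq_le sqr_ge0 andbT -x0 sqr_xc_le.
  have /= := is_derive_mul0 (@xwt_continuous z) xi0 xd.
  by rewrite /xwt2 xwt_xsq0// !mul0r mulr0 addr0.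
apply: is_derive_eq (is_deriveM (xwt_is_derive i x0) xd) _.
rewrite xwtB1// /xwt2 [_ *: 1]mulr1 [_ *: _]/GRing.scale /=.
by field; rewrite gt_eqF.
Qed.

Lemma xwt_xsq_dx i : C1_along (@dx R m k i) (fun z => xwt z * xsq z)
  (fun z => 2 * (1 + gamma) * (xwt z * xc i z)).
Proof.
have cx : continuous (xc i) by move=> z; exact: coord_continuous.
split=> [||z].
- by apply: continuousM_fun; [exact: xwt_continuous|exact: xsq_continuous].
- apply: continuousM_fun; first exact: cst_continuous.
  by apply: continuousM_fun => //; exact: xwt_continuous.
have xd : is_derive z (@dx R m k i) xsq (2 * xc i z) by have [_ _] := xsq_dx i; apply.
have := xsq_ge0 z; rewrite le_eqVlt => /predU1P[/esym x0|x0].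
  have /= := is_derive_mul0 (@xwt_continuous z) x0 xd.
  by rewrite xwt_xsq0// !mul0r mulr0.
apply: is_derive_eq (is_deriveM (xwt_is_derive i x0) xd) _.
rewrite xwtB1// ![_ *: _]/GRing.scale /=.
by field; rewrite gt_eqF.
Qed.

Lemma gau_dx i : C1_along (@dx R m k i) gau
  (fun z => 2 * (1 + gamma) * (xwt z * xc i z)).
Proof.
apply: C1_along_eq (C1_alongD (xwt_xsq_dx i) (C1_alongZ ((1 + gamma) ^+ 2) (ysq_dx i))) => // z.
by rewrite mulr0 addr0.
Qed.

Lemma gau_dy j : C1_along (@dy R m k j) gau (fun z => 2 * (1 + gamma) ^+ 2 * yc j z).
Proof.
apply: C1_along_eq (C1_alongD (C1_alongM (xwt_dy j) (xsq_dy j))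
  (C1_alongZ ((1 + gamma) ^+ 2) (ysq_dy j))) => // z.
by ring.
Qed.

Lemma gau_continuous : continuous gau.
Proof.
apply: continuousD_fun.
  by apply: continuousM_fun; [exact: xwt_continuous|exact: xsq_continuous].
apply: continuousM_fun; first exact: cst_continuous.
by apply: continuous_sum_fun => i; apply: continuousX_fun => z; exact: coord_continuous.
Qed.

Lemma enorm_sqr n (v : 'rV[R]_n) : enorm v ^+ 2 = \sum_(l < n) v ord0 l ^+ 2.
Proof. by rewrite sqr_sqrtr// sumr_ge0// => l _; exact: sqr_ge0. Qed.

Lemma enorm_ge0 n (v : 'rV[R]_n) : 0 <= enorm v.
Proof. exact: sqrtr_ge0. Qed.

Lemma enorm_powR n (v : 'rV[R]_n) r : enorm v `^ (2 * r) = (\sum_(l < n) v ord0 l ^+ 2) `^ r.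
Proof. by rewrite powRrM powR_mulrn ?enorm_ge0// enorm_sqr. Qed.

Lemma sum_xpart z : \sum_(l < m) xpart z ord0 l ^+ 2 = xsq z.
Proof. by apply: eq_bigr => l _; rewrite mxE. Qed.

Lemma sum_ypart z : \sum_(l < k) ypart z ord0 l ^+ 2 = ysq z.
Proof. by apply: eq_bigr => l _; rewrite mxE. Qed.

Lemma xwtE z : enorm (xpart z) `^ (2 * gamma) = xwt z.
Proof. by rewrite enorm_powR sum_xpart. Qed.

Lemma rhoE z : rho gamma z = gau z `^ (1 / (2 * (1 + gamma))).
Proof.
rewrite /rho enorm_powR sum_xpart enorm_sqr sum_ypart /gau; congr ((_ + _) `^ _).
have [x0|x0] := eqVneq (xsq z) 0.
  by rewrite x0 mulr0 powR0// gt_eqF// ltr_wpDr// ltW.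
by rewrite powRD ?x0 ?implybT// powRr1 ?xsq_ge0// mulrC.
Qed.

Definition gradsq (f : V -> R) z : R :=
  \sum_(i < m) ('D_(@dx R m k i) f z) ^+ 2 + xwt z * \sum_(j < k) ('D_(@dy R m k j) f z) ^+ 2.

Lemma gradsq_ge0 f z : 0 <= gradsq f z.
Proof.
by rewrite addr_ge0 ?mulr_ge0 ?xwt_ge0// sumr_ge0// => l _; exact: sqr_ge0.
Qed.

Lemma enorm_grad_sqr f z : enorm (grad_g gamma f z) ^+ 2 = gradsq f z.
Proof.
rewrite enorm_sqr big_split_ord /=; congr (_ + _).
  by apply: eq_bigr => i _; rewrite row_mxEl mxE.
rewrite mulr_sumr; apply: eq_bigr => j _; rewrite row_mxEr mxE exprMn; congr (_ * _).
by rewrite -xwtE -powR_mulrn ?powR_ge0// -powRrM mulrC.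
Qed.

Lemma gau_gt0 z : xsq z != 0 -> 0 < gau z.
Proof.
move=> x0; have x1 : 0 < xsq z by rewrite lt_def x0 xsq_ge0.
by rewrite ltr_wpDr ?mulr_gt0 ?powR_gt0// mulr_ge0 ?ysq_ge0 ?sqr_ge0.
Qed.

(** The exponent equals [- gamma / (1 + gamma)], so this is the square of
    [|grad rho| = |x|^gamma / rho^gamma]. After the common power of [gau] is factored out, the
    remaining sum is [xwt * gau]. *)
Lemma gradsq_rho z : xsq z != 0 ->
  gradsq (rho gamma) z = xwt z * gau z `^ (1 / (1 + gamma) - 1).
Proof.
move=> x0; have g0 := gau_gt0 x0.
have p0 : 1 + gamma != 0 by rewrite gt_eqF// addr_gt0.
set b := 1 / (2 * (1 + gamma)).
have rE : rho gamma = (fun z => gau z `^ b) by apply/funext => w; exact: rhoE.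
have Dx i : 'D_(@dx R m k i) (rho gamma) z = gau z `^ (b - 1) * (xwt z * xc i z).
  have [_ _ /(_ z) dg] := gau_dx i.
  rewrite rE (@derive_val _ _ _ _ _ _ _ (is_derive_powR b g0 dg)) /b.
  by field; rewrite p0.
have Dy j : 'D_(@dy R m k j) (rho gamma) z = gau z `^ (b - 1) * ((1 + gamma) * yc j z).
  have [_ _ /(_ z) dg] := gau_dy j.
  rewrite rE (@derive_val _ _ _ _ _ _ _ (is_derive_powR b g0 dg)) /b.
  by field; rewrite p0.
rewrite /gradsq; under eq_bigr do rewrite Dx !exprMn.
under [X in _ + _ * X]eq_bigr do rewrite Dy !exprMn.
rewrite -!mulr_sumr -/(xsq z) -/(ysq z).
have -> : 1 / (1 + gamma) - 1 = (b - 1) + (b - 1) + 1 by rewrite /b; field.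
move: (b - 1) => c.
have gD r s : gau z `^ (r + s) = gau z `^ r * gau z `^ s.
  by rewrite powRD// (gt_eqF g0) implybT.
by rewrite !gD powRr1 ?ltW//; set E := gau z `^ c; rewrite /gau; ring.
Qed.

End grushin_geometry.

(** * The pointwise inequality *)

(* Here [d = alpha - 2], [t = (Q - alpha)/2], [g = gamma], [a = d/(2(1+g))] and [y = T^e], so that
   [Q + alpha - 4 = 2(t + d)] and [mu = (Q - alpha)(Q + 3 alpha - 8)/4]. *)
Section scalar_inequalities.
Variable R : realType.
Implicit Types (t d p b e c y T N : R).

(** The terms free of [y] cancel, because [(t (t + d))^2 + mu (t + d)^2 = 2 t (t + d)^3]. One half
    of [2 p mu b e y] pays for [mu (b y)^2], the other for the cost of dividing [h^2] by
    [1 - c y]. *)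
Lemma bracket_gauge t d p b e c y (h := t + d + b * y) (mu := 2 * t * d + t ^+ 2) :
  0 < t -> 0 < d -> 0 < b -> 0 < c -> 0 < y -> c * y <= 1 / 2 -> b * y <= p * e ->
  2 * c * h ^+ 2 <= p * b * e ->
  (t * (t + d)) ^+ 2 + 2 * (t + d) * (- (t * (t + d) ^+ 2) - mu * b * y)
    - 2 * p * mu * b * e * y + mu * (h ^+ 2 / (1 - c * y)) <= 0.
Proof.
move=> t0 d0 b0 c0 y0 cy by_le ch.
have cy0 : 0 < c * y by rewrite mulr_gt0.
have mu0 : 0 < mu by rewrite /mu addr_gt0 ?exprn_gt0 ?mulr_gt0.
have hw : h ^+ 2 / (1 - c * y) <= h ^+ 2 + p * b * e * y.
  rewrite ler_pdivrMr; last by lra.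
  have h2 : 0 <= h ^+ 2 by exact: sqr_ge0.
  have chy : 2 * c * h ^+ 2 * y <= p * b * e * y by rewrite ler_pM2r.
  have cyh : 0 <= c * y * (1 - 2 * (c * y)) * h ^+ 2.
    by rewrite mulr_ge0// mulr_ge0 ?(ltW cy0)//; lra.
  have E : 0 <= (p * b * e * y - 2 * c * h ^+ 2 * y) * (1 - c * y).
    by rewrite mulr_ge0//; lra.
  by lra.
have := ler_wpM2l (ltW mu0) hw.
have : mu * b * y * (b * y) <= mu * b * y * (p * e).
  by rewrite ler_wpM2l// ltW// !mulr_gt0.
by rewrite /h /mu; lra.
Qed.

(** Here [(t (t + d))^2] is [t] times [t (t + d)^2], and the factor [2 t + d + 2 + 2 g] exceeds
    [t]. *)
Lemma bracket_regularization t d g b y (mu := 2 * t * d + t ^+ 2) :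
  0 < t -> 0 < d -> 0 < g -> 0 < b -> 0 < y ->
  (t * (t + d)) ^+ 2 + (2 * t + d + 2 + 2 * g) * (- (t * (t + d) ^+ 2) - mu * b * y) <= 0.
Proof.
move=> t0 d0 g0 b0 y0.
have mu0 : 0 < mu by rewrite /mu addr_gt0 ?exprn_gt0 ?mulr_gt0.
have mby : 0 < mu * b * y by rewrite !mulr_gt0.
have td : 0 < t * (t + d) ^+ 2 by rewrite mulr_gt0// exprn_gt0// addr_gt0.
have : t * (t * (t + d) ^+ 2) <= (2 * t + d + 2 + 2 * g) * (t * (t + d) ^+ 2).
  by rewrite ler_pM2r//; lra.
have : 0 <= (2 * t + d + 2 + 2 * g) * (mu * b * y) by rewrite mulr_ge0 ?ltW//; lra.
by lra.
Qed.

(* The left-hand side is affine in [N]; the two previous lemmas are its values at [N = T] and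
   [N = 0], divided by [T]. *)
Lemma bracket_le0 t d g b e c y a T N (h := t + d + b * y) (mu := 2 * t * d + t ^+ 2) :
  0 < t -> 0 < d -> 0 < g -> 0 < b -> 0 < c -> 0 < y ->
  2 * (1 + g) * a = d -> c * y <= 1 / 2 -> b * y <= (1 + g) * e ->
  2 * c * h ^+ 2 <= (1 + g) * b * e -> 0 <= N <= T ->
  (t * (t + d)) ^+ 2 * T + (2 * t + d + 2 + 2 * g) * T * (- (t * (t + d) ^+ 2) - mu * b * y)
  + 2 * (1 + g) * N * ((a - 1) * - (t * (t + d) ^+ 2) - mu * b * (a - 1 + e) * y)
  + mu * (h ^+ 2 / (1 - c * y)) * N <= 0.
Proof.
move=> t0 d0 g0 b0 c0 y0 ad cy by_le ch /andP[N0 NT].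
have B1 := bracket_gauge t0 d0 b0 c0 y0 cy by_le ch.
have B0 := bracket_regularization t0 d0 g0 b0 y0.
rewrite -/h -/mu in B1; rewrite -/mu in B0.
set W := h ^+ 2 / (1 - c * y) in B1 *.
have {}B1 := mulr_ge0_le0 N0 B1.
have {}B0 : (T - N) * ((t * (t + d)) ^+ 2 + (2 * t + d + 2 + 2 * g)
   * (- (t * (t + d) ^+ 2) - mu * b * y)) <= 0.
  by apply: mulr_ge0_le0 => //; rewrite subr_ge0.
by move: B0 B1; rewrite -ad; clear; move: mu W => mu W; lra.
Qed.

(* [A], [B] stand for [|grad_x f|^2], [|grad_y f|^2], [Lx], [Ly] for the Laplacians, [Zx], [Zy] for
   [x . grad_x f], [y . grad_y f], [P] for [|x|^(2g)], [u] for [T^(a-2)]; the two bracketed sums are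
   the divergence of the field. *)
Lemma divergence_le t d g b e c y a T u P X Y f A B Lx Ly Zx Zy m k
    (mu := 2 * t * d + t ^+ 2) (s := t * (t + d)) (N := P * X + (1 + g) ^+ 2 * Y)
    (K := T * u * (- (t * (t + d) ^+ 2) - mu * b * y))
    (K' := u * ((a - 1) * - (t * (t + d) ^+ 2) - mu * b * (a - 1 + e) * y)) :
  0 < t -> 0 < d -> 0 < g -> 0 < b -> 0 < c -> 0 < y ->
  2 * (1 + g) * a = d -> c * y <= 1 / 2 -> b * y <= (1 + g) * e ->
  2 * c * (t + d + b * y) ^+ 2 <= (1 + g) * b * e ->
  m + (1 + g) * k = 2 * t + d + 2 -> 0 <= P -> 0 <= u -> 0 < T -> 0 <= N <= T ->
  (forall r, 0 <= A + 2 * r * Zx + r ^+ 2 * X) ->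
  (forall r, 0 <= B + 2 * r * Zy + r ^+ 2 * Y) ->
  t ^+ 2 * (T ^+ 2 * u * (A + P * B)) + mu * c * (y * (T ^+ 2 * u) * (A + P * B))
  + (- (2 * s) * T ^+ 2 * u * A - 2 * s * T ^+ 2 * u * f * Lx
     + (2 * K * P * f - 4 * s * (1 + g) * a * (T * u) * P * f) * Zx
     + (m + 2 * g) * P * K * f ^+ 2 + 2 * (1 + g) * K' * P ^+ 2 * f ^+ 2 * X)
  + (- (2 * s) * T ^+ 2 * u * P * B - 2 * s * T ^+ 2 * u * f * P * Ly
     + (2 * K * (1 + g) * P * f - 4 * s * (1 + g) ^+ 2 * a * (T * u) * P * f) * Zy
     + (1 + g) * k * P * K * f ^+ 2 + 2 * (1 + g) ^+ 3 * K' * P * f ^+ 2 * Y)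
  <= - (2 * s) * (T ^+ 2 * u) * f * (Lx + P * Ly) - s ^+ 2 * P * (T * u) * f ^+ 2.
Proof.
move=> t0 d0 g0 b0 c0 y0 ad cy by_le ch mk P0 u0 T0 NT SA SB.
have := bracket_le0 t0 d0 g0 b0 c0 y0 ad cy by_le ch NT.
rewrite -/mu -/s => B0.
have mu0 : 0 < mu by rewrite /mu addr_gt0 ?exprn_gt0 ?mulr_gt0.
pose w := 1 - c * y; have w0 : 0 < w by rewrite /w; lra.
(* The cross terms carry [mu (t + d + b y)], while the gradient terms keep only [mu w] once [mu c y]
   has gone to the gain; their quotient is the slope that completes the squares. *)
pose hw := (t + d + b * y) / w.
have hwE : hw * w = t + d + b * y by rewrite /hw mulfVK// gt_eqF.
have T1 : T != 0 by rewrite gt_eqF.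
have S1 : 0 <= T ^+ 2 * A + 2 * T * (hw * P * f) * Zx + (hw * P * f) ^+ 2 * X.
  have := mulr_ge0 (sqr_ge0 T) (SA (hw * P * f / T)).
  by congr (_ <= _); field.
have S2 : 0 <= T ^+ 2 * B + 2 * T * (hw * (1 + g) * f) * Zy + (hw * (1 + g) * f) ^+ 2 * Y.
  have := mulr_ge0 (sqr_ge0 T) (SB (hw * (1 + g) * f / T)).
  by congr (_ <= _); field.
have {}S1 : 0 <= mu * w * u * (T ^+ 2 * A + 2 * T * (hw * P * f) * Zx + (hw * P * f) ^+ 2 * X).
  by rewrite mulr_ge0// mulr_ge0// mulr_ge0// ltW.
have {}S2 : 0 <= mu * w * u * P * (T ^+ 2 * B + 2 * T * (hw * (1 + g) * f) * Zy
    + (hw * (1 + g) * f) ^+ 2 * Y).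
  by rewrite mulr_ge0// mulr_ge0// mulr_ge0// mulr_ge0// ltW.
have WE : (t + d + b * y) ^+ 2 / (1 - c * y) = hw ^+ 2 * w.
  by rewrite -hwE -/w; field; rewrite gt_eqF.
rewrite WE in B0.
have {}B0 : P * f ^+ 2 * u * (s ^+ 2 * T + (2 * t + d + 2 + 2 * g) * T *
     (- (t * (t + d) ^+ 2) - mu * b * y) +
     2 * (1 + g) * N * ((a - 1) * - (t * (t + d) ^+ 2) - mu * b * (a - 1 + e) * y) +
     mu * (hw ^+ 2 * w) * N) <= 0.
  by rewrite mulr_ge0_le0// mulr_ge0// mulr_ge0// sqr_ge0.
have vE : b * y = hw * w - t - d by rewrite hwE; ring.
have cE : c * y = 1 - w by rewrite /w; ring.
have mE : m = 2 * t + d + 2 - (1 + g) * k by rewrite -mk; ring.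
rewrite -subr_ge0.
set goal := (X in 0 <= X).
(* The difference of the two sides is exactly the two weighted squares minus the bracket. *)
suff -> : goal = mu * w * u * (T ^+ 2 * A + 2 * T * (hw * P * f) * Zx + (hw * P * f) ^+ 2 * X)
  + mu * w * u * P * (T ^+ 2 * B + 2 * T * (hw * (1 + g) * f) * Zy + (hw * (1 + g) * f) ^+ 2 * Y)
  - P * f ^+ 2 * u * (s ^+ 2 * T + (2 * t + d + 2 + 2 * g) * T *
     (- (t * (t + d) ^+ 2) - mu * b * y) +
     2 * (1 + g) * N * ((a - 1) * - (t * (t + d) ^+ 2) - mu * b * (a - 1 + e) * y) +
     mu * (hw ^+ 2 * w) * N).
  by rewrite subr_ge0 (le_trans B0)// addr_ge0.
rewrite /goal /K /K' /N mE.
have bE : b = (hw * w - t - d) / y by rewrite -vE mulfK// gt_eqF.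
have {}cE : c = (1 - w) / y by rewrite -cE mulfK// gt_eqF.
have y1 : y != 0 by rewrite gt_eqF.
(* Eliminating [b], [c], [d] and [m] solves the constraints, so that a free rational identity is
   left. *)
clear -bE cE y1 ad; clearbody hw w; rewrite bE cE /mu /s -ad.
by field.
Qed.

End scalar_inequalities.

Lemma smooth_C1_along (R : realType) n (f : 'rV[R]_n -> R) (ds : seq 'rV[R]_n) d : smooth f ->
  C1_along d (Defs.iterD ds f) ('D_d (Defs.iterD ds f)).
Proof.
move=> sf; split; [exact: (sf ds).1|exact: (sf (d :: ds)).1|].
by move=> z; apply/derivableP; exact: (sf ds).2.
Qed.

(** * The vector field and its divergence *)

Section field.
Variables (R : realType) (m k : nat) (gamma : R).
Hypothesis gamma0 : 0 < gamma.
Local Notation V := 'rV[R]_(m + k).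
Local Notation gau := (@gau R m k gamma).
Local Notation xwt := (@xwt R m k gamma).
Variables (a ep s c1 c2 tau : R).
Hypothesis tau0 : 0 < tau.

Definition rgau (z : V) := gau z + tau.

Lemma rgau_ge z : tau <= rgau z.
Proof. by rewrite lerDr gau_ge0. Qed.

Lemma rgau_gt0 z : 0 < rgau z.
Proof. exact: lt_le_trans (rgau_ge z). Qed.

Lemma rgauD z x y : rgau z `^ (x + y) = rgau z `^ x * rgau z `^ y.
Proof. by rewrite powRD// (gt_eqF (rgau_gt0 z)) implybT. Qed.

Lemma rgau_along e dg : C1_along e gau dg -> C1_along e rgau dg.
Proof.
move=> H; apply: C1_along_eq (C1_alongD H (C1_along_cst e tau)) => // z.
by rewrite addr0.
Qed.

Lemma rgau_powR_along e dg r : C1_along e gau dg ->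
  C1_along e (fun z => rgau z `^ r) (fun z => r * rgau z `^ (r - 1) * dg z).
Proof. by move=> /rgau_along; exact: C1_along_powR rgau_gt0. Qed.

Lemma rgau_powR_continuous r : continuous (fun z => rgau z `^ r).
Proof.
apply: powR_continuousP; last exact: rgau_gt0.
by apply: continuousD_fun; [exact: gau_continuous|exact: cst_continuous].
Qed.

(* The [i]-th component of the field is [-2 s T^a phi psi + prof(T) w phi^2], with [psi] a
   derivative of [phi] and [w] a component of [|x|^(2 gamma)] times the dilation field
   [(x, (1 + gamma) y)]. *)
Definition prof z := c1 * rgau z `^ (a - 1) + c2 * rgau z `^ (a - 1 + ep).
Definition dprof z := c1 * (a - 1) * rgau z `^ (a - 2)
  + c2 * (a - 1 + ep) * rgau z `^ (a - 2 + ep).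

Lemma prof_along e dg : C1_along e gau dg -> C1_along e prof (fun z => dprof z * dg z).
Proof.
move=> H; apply: C1_along_eq (C1_alongD (C1_alongZ c1 (rgau_powR_along (a - 1) H))
  (C1_alongZ c2 (rgau_powR_along (a - 1 + ep) H))) => // z.
rewrite /dprof (_ : a - 1 - 1 = a - 2); last by ring.
by rewrite (_ : a - 1 + ep - 1 = a - 2 + ep); ring.
Qed.

Definition fieldF (phi psi w : V -> R) z :=
  phi z * (- (2 * s) * (rgau z `^ a * psi z) + prof z * (w z * phi z)).

Definition fieldG (phi psi w dphi dpsi dw dg : V -> R) z :=
  dphi z * (- (2 * s) * (rgau z `^ a * psi z) + prof z * (w z * phi z))
  + phi z * (- (2 * s) * (a * rgau z `^ (a - 1) * dg z * psi z + rgau z `^ a * dpsi z)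
    + dprof z * dg z * (w z * phi z) + prof z * (dw z * phi z + w z * dphi z)).

Lemma field_along e phi psi w dphi dpsi dw dg : C1_along e phi dphi ->
  C1_along e psi dpsi -> C1_along e w dw -> C1_along e gau dg ->
  C1_along e (fieldF phi psi w) (fieldG phi psi w dphi dpsi dw dg).
Proof.
move=> Hphi Hpsi Hw Hg.
apply: C1_along_eq (C1_alongM Hphi (C1_alongD
  (C1_alongZ (- (2 * s)) (C1_alongM (rgau_powR_along a Hg) Hpsi))
  (C1_alongM (prof_along Hg) (C1_alongM Hw Hphi)))) => // z.
by rewrite /fieldG; ring.
Qed.

Variable phi : V -> R.
Hypothesis smooth_phi : smooth phi.

Definition fieldFx (i : 'I_m) :=
  fieldF phi ('D_(@dx R m k i) phi) (fun z => xwt z * xc i z).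
Definition fieldGx (i : 'I_m) :=
  fieldG phi ('D_(@dx R m k i) phi) (fun z => xwt z * xc i z)
    ('D_(@dx R m k i) phi) ('D_(@dx R m k i) ('D_(@dx R m k i) phi))
    (fun z => xwt z + 2 * gamma * xwt2 gamma i z)
    (fun z => 2 * (1 + gamma) * (xwt z * xc i z)).
Definition fieldFy (j : 'I_k) :=
  fieldF phi (fun z => xwt z * 'D_(@dy R m k j) phi z)
    (fun z => xwt z * ((1 + gamma) * yc j z)).
Definition fieldGy (j : 'I_k) :=
  fieldG phi (fun z => xwt z * 'D_(@dy R m k j) phi z)
    (fun z => xwt z * ((1 + gamma) * yc j z)) ('D_(@dy R m k j) phi)
    (fun z => xwt z * 'D_(@dy R m k j) ('D_(@dy R m k j) phi) z)
    (fun z => xwt z * (1 + gamma)) (fun z => 2 * (1 + gamma) ^+ 2 * yc j z).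

Lemma fieldx_along i : C1_along (@dx R m k i) (fieldFx i) (fieldGx i).
Proof.
apply: field_along; [exact: (smooth_C1_along [::] _ smooth_phi)|
  exact: (smooth_C1_along [:: @dx R m k i] _ smooth_phi)|exact: xwt_xc_dx|exact: gau_dx].
Qed.

Lemma fieldy_along j : C1_along (@dy R m k j) (fieldFy j) (fieldGy j).
Proof.
have wj := @xwt_dy R m k gamma gamma0 j.
apply: field_along; [exact: (smooth_C1_along [::] _ smooth_phi)| | |exact: gau_dy].
- have phij := smooth_C1_along [:: @dy R m k j] (@dy R m k j) smooth_phi.
  apply: C1_along_eq (C1_alongM wj phij) => // z.
  by rewrite /= mulr0 addr0.
- have yj : C1_along (@dy R m k j) (yc j) (fun=> 1).
    apply: C1_along_eq (C1_along_coord (@dy R m k j) (rshift m j)) => // z.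
    by rewrite -/(yc j (dy _ _ j)) yc_dy eqxx.
  by apply: C1_along_eq (C1_alongM wj (C1_alongZ (1 + gamma) yj)) => // z; ring.
Qed.

(** Summation turns the quotients [xwt2] into [xwt], whence the coefficient [m + 2 gamma]. The terms
    are arranged as in [divergence_le]. *)
Lemma sum_fieldGx z : \sum_(i < m) fieldGx i z =
  - (2 * s) * rgau z `^ a * (\sum_(i < m) 'D_(@dx R m k i) phi z ^+ 2)
  - 2 * s * rgau z `^ a * phi z * (\sum_(i < m) 'D_(@dx R m k i) ('D_(@dx R m k i) phi) z)
  + (2 * prof z * xwt z * phi z - 4 * s * (1 + gamma) * a * rgau z `^ (a - 1) * xwt z * phi z)
     * (\sum_(i < m) xc i z * 'D_(@dx R m k i) phi z)
  + (m%:R + 2 * gamma) * xwt z * prof z * phi z ^+ 2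
  + 2 * (1 + gamma) * dprof z * xwt z ^+ 2 * phi z ^+ 2 * xsq z.
Proof.
transitivity (\sum_(i < m) (- (2 * s) * rgau z `^ a * 'D_(@dx R m k i) phi z ^+ 2
  - 2 * s * rgau z `^ a * phi z * 'D_(@dx R m k i) ('D_(@dx R m k i) phi) z
  + (2 * prof z * xwt z * phi z - 4 * s * (1 + gamma) * a * rgau z `^ (a - 1) * xwt z * phi z)
     * (xc i z * 'D_(@dx R m k i) phi z)
  + xwt z * prof z * phi z ^+ 2
  + 2 * gamma * prof z * phi z ^+ 2 * xwt2 gamma i z
  + 2 * (1 + gamma) * dprof z * xwt z ^+ 2 * phi z ^+ 2 * xc i z ^+ 2)).
  by apply: eq_bigr => i _; rewrite /fieldGx /fieldG; ring.
rewrite !big_split /= sumrN -!mulr_sumr sumr_const card_ord -[_ *+ m]mulr_natl sum_xwt2//.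
by rewrite -/(xsq z); ring.
Qed.

Lemma sum_fieldGy z : \sum_(j < k) fieldGy j z =
  - (2 * s) * rgau z `^ a * xwt z * (\sum_(j < k) 'D_(@dy R m k j) phi z ^+ 2)
  - 2 * s * rgau z `^ a * phi z * xwt z
     * (\sum_(j < k) 'D_(@dy R m k j) ('D_(@dy R m k j) phi) z)
  + (2 * prof z * (1 + gamma) * xwt z * phi z
     - 4 * s * (1 + gamma) ^+ 2 * a * rgau z `^ (a - 1) * xwt z * phi z)
     * (\sum_(j < k) yc j z * 'D_(@dy R m k j) phi z)
  + (1 + gamma) * k%:R * xwt z * prof z * phi z ^+ 2
  + 2 * (1 + gamma) ^+ 3 * dprof z * xwt z * phi z ^+ 2 * ysq z.
Proof.
transitivity (\sum_(j < k) (- (2 * s) * rgau z `^ a * xwt z * 'D_(@dy R m k j) phi z ^+ 2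
  - 2 * s * rgau z `^ a * phi z * xwt z * 'D_(@dy R m k j) ('D_(@dy R m k j) phi) z
  + (2 * prof z * (1 + gamma) * xwt z * phi z
     - 4 * s * (1 + gamma) ^+ 2 * a * rgau z `^ (a - 1) * xwt z * phi z)
     * (yc j z * 'D_(@dy R m k j) phi z)
  + (1 + gamma) * xwt z * prof z * phi z ^+ 2
  + 2 * (1 + gamma) ^+ 3 * dprof z * xwt z * phi z ^+ 2 * yc j z ^+ 2)).
  by apply: eq_bigr => j _; rewrite /fieldGy /fieldG; ring.
rewrite !big_split /= sumrN -!mulr_sumr sumr_const card_ord -[_ *+ k]mulr_natl.
by rewrite -/(ysq z); ring.
Qed.

Lemma lap_gE z : lap_g gamma phi z =
  \sum_(i < m) 'D_(@dx R m k i) ('D_(@dx R m k i) phi) z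
  + xwt z * \sum_(j < k) 'D_(@dy R m k j) ('D_(@dy R m k j) phi) z.
Proof. by rewrite /lap_g xwtE. Qed.

End field.

Lemma sumsq_ge0 (R : realType) n (f g : 'I_n -> R) r :
  0 <= \sum_(i < n) f i ^+ 2 + 2 * r * (\sum_(i < n) g i * f i)
    + r ^+ 2 * (\sum_(i < n) g i ^+ 2).
Proof.
have -> : \sum_(i < n) f i ^+ 2 + 2 * r * (\sum_(i < n) g i * f i)
    + r ^+ 2 * (\sum_(i < n) g i ^+ 2) = \sum_(i < n) (f i + r * g i) ^+ 2.
  by rewrite !mulr_sumr -!big_split /=; apply: eq_bigr => i _; ring.
by apply: sumr_ge0 => i _; exact: sqr_ge0.
Qed.

Section pointwise.
Variables (R : realType) (m k : nat) (gamma : R) (t d b ep c a tau : R).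
Hypotheses (gamma0 : 0 < gamma) (t0 : 0 < t) (d0 : 0 < d) (b0 : 0 < b) (c0 : 0 < c).
Hypotheses (tau0 : 0 < tau) (ad : 2 * (1 + gamma) * a = d).
Hypothesis QE : Qdim m k gamma = 2 * t + d + 2.
Local Notation mu := (2 * t * d + t ^+ 2).
Local Notation s := (t * (t + d)).
Local Notation V := 'rV[R]_(m + k).
Local Notation c1 := (- (t * (t + d) ^+ 2)).
Local Notation c2 := (- (mu * b)).

(** The profile has [c1 = s d - mu (t + d)] and [c2 = - mu b]: the part [s d] cancels what
    differentiating [T^a] produces, and the rest is [- mu] times the perturbed Hardy slope. Writing
    all powers of [T] through [u = T^(a-2)] and [y = T^ep] reduces the claim to [divergence_le]. *)
Lemma pointwise_le (phi : V -> R) z (y := rgau gamma tau z `^ ep) :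
  c * y <= 1 / 2 -> b * y <= (1 + gamma) * ep ->
  2 * c * (t + d + b * y) ^+ 2 <= (1 + gamma) * b * ep ->
  t ^+ 2 * (rgau gamma tau z `^ a * gradsq gamma phi z)
  + mu * c * (rgau gamma tau z `^ (a + ep) * gradsq gamma phi z)
  + \sum_(i < m) fieldGx gamma a ep s c1 c2 tau phi i z
  + \sum_(j < k) fieldGy gamma a ep s c1 c2 tau phi j z
  <= - (2 * s) * rgau gamma tau z `^ a * phi z * lap_g gamma phi z
     - s ^+ 2 * xwt gamma z * rgau gamma tau z `^ (a - 1) * phi z ^+ 2.
Proof.
move=> cy by_ le_b.
pose T := rgau gamma tau z; have T0 : 0 < T by exact: rgau_gt0.
pose u := T `^ (a - 2).
have TD x x' : T `^ (x + x') = T `^ x * T `^ x' by exact: rgauD.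
have uT : T `^ (a - 1) = T * u.
  have -> : a - 1 = 1 + (a - 2) by ring.
  by rewrite TD powRr1 ?ltW.
have uTT : T `^ a = T ^+ 2 * u.
  have -> : T `^ a = T `^ (1 + (a - 1)) by congr (_ `^ _); ring.
  by rewrite TD uT powRr1 ?ltW//; ring.
have := @divergence_le _ t d gamma b ep c y a T u (xwt gamma z) (xsq z) (ysq z) (phi z)
  (\sum_(i < m) 'D_(@dx R m k i) phi z ^+ 2) (\sum_(j < k) 'D_(@dy R m k j) phi z ^+ 2)
  (\sum_(i < m) 'D_(@dx R m k i) ('D_(@dx R m k i) phi) z)
  (\sum_(j < k) 'D_(@dy R m k j) ('D_(@dy R m k j) phi) z)
  (\sum_(i < m) xc i z * 'D_(@dx R m k i) phi z)
  (\sum_(j < k) yc j z * 'D_(@dy R m k j) phi z) m%:R k%:R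
  t0 d0 gamma0 b0 c0 (powR_gt0 _ T0) ad cy by_ le_b QE (xwt_ge0 _ _)
  (powR_ge0 _ _) T0.
rewrite -/(gau gamma z) gau_ge0 /T lerDl (ltW tau0) => /(_ isT).
move=> /(_ (fun r => sumsq_ge0 _ _ r) (fun r => sumsq_ge0 _ _ r)).
rewrite sum_fieldGx// sum_fieldGy// lap_gE -/T /prof /dprof -/T (TD a ep)
  (TD (a - 1) ep) (TD (a - 2) ep) -/u -/y uT uTT.
rewrite /gradsq.
set A := \sum_(i < m) _ ^+ 2; set B := \sum_(j < k) 'D_ _ phi z ^+ 2.
by apply: le_trans; rewrite le_eqVlt; apply/orP; left; apply/eqP; ring.
Qed.

End pointwise.

(** * Integration and removal of the regularization *)

Section powR_inequalities.
Variable R : realType.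
Implicit Types (x y r q : R).

(** A weighted geometric mean is at most the larger of its two entries. *)
Lemma young_le_add x y r : 0 < x -> 0 < y -> 0 < r < 1 ->
  x `^ r * y `^ (1 - r) <= x + y.
Proof.
move=> x0 y0 /andP[r0 r1].
have r1' : 0 <= 1 - r by rewrite subr_ge0 ltW.
have P w : 0 < w -> w `^ r * w `^ (1 - r) = w.
  by move=> w0; rewrite -powRD ?(gt_eqF w0) ?implybT// addrC subrK powRr1 ?ltW.
have [xy|/ltW yx] := leP x y.
  apply: le_trans (_ : y <= _); last by rewrite lerDr ltW.
  rewrite -[leRHS](P y y0).
  apply: ler_wpM2r; first exact: powR_ge0.
  by apply: ge0_ler_powR; rewrite ?nnegrE //; exact: ltW.
apply: le_trans (_ : x <= _); last by rewrite lerDl ltW.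
rewrite -[leRHS](P x x0).
apply: ler_wpM2l; first exact: powR_ge0.
by apply: ge0_ler_powR; rewrite ?nnegrE //; exact: ltW.
Qed.

(** In the product of the [q/2]-th power of the first summand and the [(1 - q/2)]-th power of the
    second, the powers of [lam] and of [T] cancel and [v^(q/2)] remains. *)
Lemma young_weight q sg (T v lam : R) : 1 < q < 2 -> 0 < T -> 0 <= v -> 0 < lam ->
  v `^ (q / 2) <= lam * (v * T `^ (sg * (2 - q) / q))
    + lam `^ (- (q / (2 - q))) * T `^ (- sg).
Proof.
move=> /andP[q1 q2] T0; rewrite le_eqVlt => /predU1P[<-|v0] lam0.
  by rewrite powR0 ?mul0r ?mulr0 ?add0r ?mulr_ge0 ?powR_ge0//; lra.
have qn : q != 0 by rewrite gt_eqF//; lra.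
have q2n : 2 - q != 0 by rewrite gt_eqF//; lra.
have TD : forall r s, T `^ (r + s) = T `^ r * T `^ s.
  by move=> r s; rewrite powRD// (gt_eqF T0) implybT.
have LD : forall r s, lam `^ (r + s) = lam `^ r * lam `^ s.
  by move=> r s; rewrite powRD// (gt_eqF lam0) implybT.
apply: le_trans (young_le_add (r := q / 2) _ _ _).
- rewrite (powRM _ (ltW lam0) (mulr_ge0 (ltW v0) (powR_ge0 _ _))).
  rewrite (powRM _ (ltW v0) (powR_ge0 _ _)) (powRM _ (powR_ge0 _ _) (powR_ge0 _ _)) -!powRrM.
  set w := (X in _ <= X).
  suff -> : w = v `^ (q / 2) *
     (lam `^ (q / 2 + - (q / (2 - q)) * (1 - q / 2)) *
      T `^ (sg * (2 - q) / q * (q / 2) + - sg * (1 - q / 2))).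
    rewrite (_ : _ + - (q / _) * _ = 0); last by field.
    rewrite (_ : _ + - sg * _ = 0); last by field.
    by rewrite !powRr0 !mulr1.
  by rewrite /w LD TD; ring.
- by rewrite !mulr_gt0 ?powR_gt0.
- by rewrite !mulr_gt0 ?powR_gt0.
- by apply/andP; split; lra.
Qed.

(** The choice [lam = X0^(-(1 - q/2))] makes both summands multiples of [X0^(q/2)]. Together with
    [young_weight] this replaces Hoelder's inequality. *)
Lemma young_optimize q (S X0 Y : R) : 1 < q < 2 -> 0 <= S -> 0 < X0 -> 0 <= Y ->
  (forall lam, 0 < lam -> S <= lam * X0 + lam `^ (- (q / (2 - q))) * Y) ->
  S `^ (2 / q) <= (1 + Y) `^ (2 / q) * X0.
Proof.
move=> /andP[q1 q2] S0 X00 Y0 H.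
have qn : q != 0 by rewrite gt_eqF//; lra.
have q2n : 2 - q != 0 by rewrite gt_eqF//; lra.
have {H} := H (X0 `^ (- (1 - q / 2))) (powR_gt0 _ X00).
rewrite -powRrM (_ : - (1 - q / 2) * - (q / (2 - q)) = q / 2); last by field.
have -> : X0 `^ (- (1 - q / 2)) * X0 = X0 `^ (q / 2).
  rewrite -[X in _ * X](powRr1 (ltW X00)) -powRD ?(gt_eqF X00) ?implybT//.
  by congr (_ `^ _); ring.
rewrite -{1}[X0 `^ _]mulr1 -mulrDr => H.
have -> : (1 + Y) `^ (2 / q) * X0 = (X0 `^ (q / 2) * (1 + Y)) `^ (2 / q).
  rewrite powRM ?powR_ge0 ?addr_ge0// -powRrM (_ : q / 2 * (2 / q) = 1); last by field.
  by rewrite powRr1 ?ltW// mulrC.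
apply: ge0_ler_powR => //; first by rewrite divr_ge0//; lra.
by rewrite nnegrE (le_trans S0).
Qed.

Lemma one_sub_exp_le x n : 0 <= x <= 1 -> 1 - x ^+ n <= n%:R * (1 - x).
Proof.
move=> /andP[x0 x1]; elim: n => [|n IH]; first by rewrite expr0 subrr mul0r.
have xn : x ^+ n <= 1 by rewrite exprn_ile1.
rewrite exprS -natr1 mulrDl mul1r.
have : x ^+ n * (1 - x) <= 1 * (1 - x) by rewrite ler_wpM2r// subr_ge0.
by lra.
Qed.

(** With [x = N/T] in [[0, 1]], [x^n <= x^r] for the integer [n >= r], and Bernoulli's bound for
    [x^n] applies. This covers [N = 0] as well. *)
Lemma powR_sub_le r n (N T : R) : 0 < r -> r <= n%:R -> 0 <= N <= T -> 0 < T ->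
  T `^ r - N `^ r <= n%:R * T `^ (r - 1) * (T - N).
Proof.
move=> r0 rn /andP[N0 NT] T0.
have Tn : T != 0 by rewrite gt_eqF.
pose x := N / T.
have x01 : 0 <= x <= 1 by rewrite divr_ge0 ?(ltW T0)//= ler_pdivrMr ?mul1r.
have -> : N = x * T by rewrite /x divfK.
have /andP[x0 x1] := x01.
clearbody x.
have TE : T `^ r = T `^ (r - 1) * T.
  rewrite -[X in _ = _ * X](powRr1 (ltW T0)) -powRD ?Tn ?implybT//.
  by congr (_ `^ _); ring.
rewrite (powRM _ x0 (ltW T0)) TE.
have -> : T `^ (r - 1) * T - x `^ r * (T `^ (r - 1) * T) = T `^ (r - 1) * T * (1 - x `^ r).
  by ring.
have -> : n%:R * T `^ (r - 1) * (T - x * T) = T `^ (r - 1) * T * (n%:R * (1 - x)) by ring.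
apply: ler_wpM2l; first by rewrite mulr_ge0 ?powR_ge0 ?ltW.
apply: le_trans (one_sub_exp_le n x01); rewrite lerD2l lerN2.
move: x0; rewrite le_eqVlt => /predU1P[<-|x0].
  by rewrite powR0 ?gt_eqF// expr0n; case: (n) rn => // /(lt_le_trans r0); rewrite ltxx.
have x2 : 0 < x <= 1 by rewrite x0.
rewrite -(powR_mulrn _ (ltW x0)).
exact: (ger_powR x2 rn).
Qed.

End powR_inequalities.

Section boxint_more.
Variables (R : realType) (M : R).
Hypothesis M0 : 0 < M.

Lemma cube_bounded n (f : 'rV[R]_n -> R) : continuous f ->
  exists B, 0 <= B /\ forall z, cube M n z -> `|f z| <= B.
Proof.
move=> cf; have /compact_bounded[B [_ HB]] : compact (f @` cube M n).
  by apply: continuous_compact; [exact: continuous_subspaceT|exact: cube_compact].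
exists (Num.max B 0 + 1); split; first by rewrite addr_ge0// le_max lexx orbT.
move=> z zM; apply: (HB (Num.max B 0 + 1)); last by exists z.
by rewrite ltr_pwDr// le_max lexx.
Qed.

Lemma boxint_sum n p (f : 'I_p -> 'rV[R]_n -> R) : (forall i, continuous (f i)) ->
  boxint M (fun z => \sum_(i < p) f i z) = \sum_(i < p) boxint M (f i).
Proof.
elim: p f => [|p IH] f cf.
  under eq_fun do rewrite big_ord0.
  by rewrite boxint_cst// mulr0 big_ord0.
under eq_fun do rewrite big_ord_recl.
rewrite boxintD//; first by rewrite IH ?big_ord_recl.
by apply: continuous_sum_fun => i; exact: cf.
Qed.

Lemma boxint_derive0 n (i : 'I_n) (F G : 'rV[R]_n -> R) : C1_along (ebase R i) F G ->
  (forall z : 'rV[R]_n, `|z ord0 i| = M -> F z = 0) -> boxint M G = 0.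
Proof.
move=> [cF cG dF] F0.
have := @boxint_derive_le _ _ M0 n i F G 0 cF cG dF _.
rewrite !mulr0 normr_le0 => H; apply/eqP; apply: H => z _ /F0 ->.
by rewrite normr0.
Qed.

End boxint_more.

(** * The improved Rellich inequality on the cube *)

Section improved_rellich.
Variables (R : realType) (m k : nat) (gamma M : R).
Hypotheses (gamma0 : 0 < gamma) (M1 : 1 <= M).
Local Notation V := 'rV[R]_(m + k).
Local Notation p := (1 + gamma).
Local Notation vol := ((2 * M) ^+ (m + k)).

Let M0 : 0 < M. Proof. exact: lt_le_trans M1. Qed.
Let p0 : 0 < p. Proof. by rewrite addr_gt0. Qed.
Let vol0 : 0 <= vol. Proof. by rewrite exprn_ge0// mulr_ge0// ltW. Qed.

(* [x_i T^(-1/4p)] has [x_i]-derivative at least half of [T^(-1/4p)], whence a bound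
   on the integral of the latter that does not depend on [tau]. *)
Lemma boxint_rgau_le (i : 'I_m) tau : 0 < tau ->
  boxint M (fun z : V => rgau gamma tau z `^ (- (1 / (4 * p)))) <= 4 * M * (2 * M) ^+ (m + k).-1.
Proof.
move=> tau0; set sg := - (1 / (4 * p)).
have [cF cG dF] := C1_alongM (C1_along_coord (@dx R m k i) (lshift k i))
  (rgau_powR_along tau0 sg (gau_dx k gamma0 i)).
set F := (fun z : V => _ * _) in cF dF; set G := (fun z : V => _ + _) in cG dF.
have GE z : rgau gamma tau z `^ sg <= 2 * G z.
  have T0 := rgau_gt0 gamma tau0 z.
  have -> : rgau gamma tau z `^ sg = rgau gamma tau z `^ (sg - 1) * rgau gamma tau z.
    rewrite -[X in _ = _ * X](powRr1 (ltW T0)) -powRD ?(gt_eqF T0) ?implybT//.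
    by congr (_ `^ _); ring.
  rewrite /G -/(xc i (dx _ _ i)) xc_dx eqxx mulr1 -/(xc i z).
  have -> : rgau gamma tau z `^ sg = rgau gamma tau z `^ (sg - 1) * rgau gamma tau z.
    rewrite -[X in _ = _ * X](powRr1 (ltW T0)) -powRD ?(gt_eqF T0) ?implybT//.
    by congr (_ `^ _); ring.
  have -> : 2 * (xc i z * (sg * rgau gamma tau z `^ (sg - 1) * (2 * p * (xwt gamma z * xc i z)))
      + rgau gamma tau z `^ (sg - 1) * rgau gamma tau z) =
      rgau gamma tau z `^ (sg - 1) * (2 * rgau gamma tau z - xwt gamma z * xc i z ^+ 2).
    by rewrite /sg; field; rewrite gt_eqF.
  rewrite ler_wpM2l ?powR_ge0//.
  suff : xwt gamma z * xc i z ^+ 2 <= rgau gamma tau z by lra.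
  rewrite /rgau /gau -addrA; apply: le_trans (_ : xwt gamma z * xsq z <= _).
    by rewrite ler_wpM2l ?xwt_ge0 ?sqr_xc_le.
  by rewrite lerDl addr_ge0 ?(ltW tau0)// mulr_ge0 ?sqr_ge0 ?ysq_ge0.
have cT := @rgau_powR_continuous R m k gamma gamma0 tau tau0 sg.
have c2G : continuous (fun z => 2 * G z).
  by apply: continuousM_fun => //; exact: cst_continuous.
apply: le_trans (le_boxint M0 cT c2G (fun z _ => GE z)) _.
rewrite boxintZ//.
(* On this face [|x_i| = M >= 1] forces [T >= 1], so the negative power is at most [1]; this is the
   purpose of [M >= 1]. *)
have FM z : cube M (m + k) z -> `|z ord0 (lshift k i)| = M -> `|F z| <= M.
  move=> _ zM; rewrite /F normrM zM (ger0_norm (powR_ge0 _ _)).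
  rewrite -[leRHS]mulr1 ler_wpM2l ?(ltW M0)//.
  have x1 : 1 <= xsq z.
    apply: le_trans (sqr_xc_le i z); rewrite -real_normK ?num_real// /xc zM.
    by rewrite exprn_ege1.
  have T1 : 1 <= rgau gamma tau z.
    have w1 : 1 <= xwt gamma z by rewrite -[leLHS](powRr0 (xsq z)) ler_powR// ltW.
    rewrite /rgau /gau -addrA; apply: le_trans (_ : xwt gamma z * xsq z <= _).
      by rewrite -[leLHS]mulr1 ler_pM.
    by rewrite lerDl addr_ge0 ?(ltW tau0)// mulr_ge0 ?sqr_ge0 ?ysq_ge0.
  rewrite -[leRHS](powRr0 (rgau gamma tau z)) ler_powR//.
  by rewrite oppr_le0 divr_ge0// mulr_ge0// ltW.
have := boxint_derive_le M0 cF cG dF FM.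
move=> /(le_trans (ler_norm _)) H.
apply: le_trans (ler_wpM2l (_ : 0 <= 2) H) _ => //.
by rewrite le_eqVlt; apply/orP; left; apply/eqP; ring.
Qed.

Variables (t d b ep c a : R).
Hypotheses (t0 : 0 < t) (d0 : 0 < d) (b0 : 0 < b) (c0 : 0 < c).
Hypotheses (ep0 : 0 < ep) (ad : 2 * p * a = d).
Hypothesis QE : Qdim m k gamma = 2 * t + d + 2.
Local Notation mu := (2 * t * d + t ^+ 2).
Local Notation s := (t * (t + d)).
Variable Y : R.
Hypothesis gauY : forall z, cube M (m + k) z -> (gau gamma z + 1) `^ ep <= Y.
Hypotheses (cY : c * Y <= 1 / 2) (bY : b * Y <= p * ep).
Hypothesis cbY : 2 * c * (t + d + b * Y) ^+ 2 <= p * b * ep.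

Variable phi : V -> R.
Hypothesis smooth_phi : smooth phi.
Hypothesis phi_face : forall (z : V) i, `|z ord0 i| = M -> phi z = 0.

Let a0 : 0 < a.
Proof. by move: d0; rewrite -ad pmulr_rgt0// mulr_gt0. Qed.

Lemma gradsq_continuous : continuous (gradsq gamma phi).
Proof.
apply: continuousD_fun.
  by apply: continuous_sum_fun => i; apply: continuousX_fun; exact: (smooth_phi [:: _]).1.
apply: continuousM_fun; first exact: xwt_continuous.
by apply: continuous_sum_fun => i; apply: continuousX_fun; exact: (smooth_phi [:: _]).1.
Qed.

Lemma lap_continuous : continuous (lap_g gamma phi).
Proof.
rewrite (_ : lap_g gamma phi = fun z => \sum_(i < m) 'D_(@dx R m k i) ('D_(@dx R m k i) phi) z
  + xwt gamma z * \sum_(j < k) 'D_(@dy R m k j) ('D_(@dy R m k j) phi) z); last first.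
  by apply/funext => z; rewrite lap_gE.
apply: continuousD_fun.
  by apply: continuous_sum_fun => i; exact: (smooth_phi [:: _; _]).1.
apply: continuousM_fun; first exact: xwt_continuous.
by apply: continuous_sum_fun => i; exact: (smooth_phi [:: _; _]).1.
Qed.

(** The left-hand integrand is [N^(a+1) D^2 / |x|^(2 gamma)]. Adding [tau'] to the denominator makes
    it continuous and only lowers it; keeping [N] instead of [T] in the numerator preserves the
    lower bound. *)
Definition rellich_reg tau' z : R :=
  gau gamma z `^ (a + 1) * lap_g gamma phi z ^+ 2 / (xwt gamma z + tau').

Lemma rellich_reg_continuous tau' : 0 < tau' -> continuous (rellich_reg tau').
Proof.
move=> tau'0; apply: continuousM_fun.
  apply: continuousM_fun; last by apply: continuousX_fun; exact: lap_continuous.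
  by apply: powR_continuous; [rewrite addr_gt0|exact: gau_continuous|exact: gau_ge0].
have pos (z : V) : 0 < xwt gamma z + tau' by rewrite ltr_wpDl ?xwt_ge0.
move=> z; apply: (@cvgV _ _ (nbhs z)); first exact: lt0r_neq0 (pos z).
by apply: continuousD_fun; [exact: xwt_continuous|exact: cst_continuous].
Qed.

(** The completed square is that of [T D + s (|x|^(2 gamma) + tau') phi]. The first error is the
    extra [tau'] in its last term, the second is the replacement of [N] by [T], with the denominator
    bounded below by [tau']. *)
Lemma rellich_reg_ge tau tau' z : 0 < tau -> 0 < tau' ->
  - (2 * s) * rgau gamma tau z `^ a * phi z * lap_g gamma phi z
     - s ^+ 2 * xwt gamma z * rgau gamma tau z `^ (a - 1) * phi z ^+ 2 <=
  rellich_reg tau' z + (s ^+ 2 * phi z ^+ 2 * (rgau gamma tau z `^ (a - 1) * tau')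
   + lap_g gamma phi z ^+ 2 * ((rgau gamma tau z `^ (a + 1) - gau gamma z `^ (a + 1)) / tau')).
Proof.
move=> tau0 tau'0; rewrite /rellich_reg.
have T0 := rgau_gt0 gamma tau0 z; set T := rgau _ _ z in T0 *.
have TD r r' : T `^ (r + r') = T `^ r * T `^ r'.
  by rewrite powRD// (gt_eqF T0) implybT.
set D := lap_g _ _ z; set f := phi z; set P := xwt _ z.
have P0 : 0 <= P by exact: xwt_ge0.
have Pt : 0 < P + tau' by rewrite ltr_wpDl.
set N1 := gau _ z `^ _.
have E1 : T `^ (a + 1) = T `^ (a - 1) * T ^+ 2.
  by rewrite -powR_mulrn ?(ltW T0)// -TD; congr (_ `^ _); ring.
have E2 : T `^ a = T `^ (a - 1) * T.
  by rewrite -[X in _ * X](powRr1 (ltW T0)) -TD; congr (_ `^ _); ring.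
have NT : N1 <= T `^ (a + 1).
  apply: ge0_ler_powR; rewrite ?nnegrE ?gau_ge0 ?(ltW T0)// ?addr_ge0 ?(ltW a0)//.
  by rewrite lerDl ltW.
have sq : 0 <= T `^ (a - 1) * (T * D + s * (P + tau') * f) ^+ 2 / (P + tau').
  by rewrite divr_ge0 ?(ltW Pt)// mulr_ge0 ?powR_ge0 ?sqr_ge0.
have dif : (T `^ (a + 1) - N1) * D ^+ 2 / (P + tau') <= (T `^ (a + 1) - N1) * D ^+ 2 / tau'.
  apply: ler_wpM2l; first by rewrite mulr_ge0 ?sqr_ge0 ?subr_ge0.
  by rewrite lef_pV2 ?posrE// lerDr.
rewrite -subr_ge0.
have -> : N1 * D ^+ 2 / (P + tau') +
    (s ^+ 2 * f ^+ 2 * (T `^ (a - 1) * tau') + D ^+ 2 * ((T `^ (a + 1) - N1) / tau')) -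
    (- (2 * s) * T `^ a * f * D - s ^+ 2 * P * T `^ (a - 1) * f ^+ 2) =
   T `^ (a - 1) * (T * D + s * (P + tau') * f) ^+ 2 / (P + tau')
   + ((T `^ (a + 1) - N1) * D ^+ 2 / tau' - (T `^ (a + 1) - N1) * D ^+ 2 / (P + tau')).
  by rewrite E1 E2; field; rewrite !gt_eqF.
by rewrite addr_ge0// subr_ge0.
Qed.

Let al := Num.min a 1.
Let al0 : 0 < al. Proof. by rewrite lt_min a0 ltr01. Qed.

(* With [tau' = tau^(1 - al/2)] both regularization errors are [O(tau^(al/2))]; this is
   where [al > 0], that is [alpha > 2], is needed. *)
Lemma rellich_reg_error : exists E, 0 <= E /\ forall tau z, 0 < tau <= 1 ->
  cube M (m + k) z -> let tau' := tau `^ (1 - al / 2) in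
  s ^+ 2 * phi z ^+ 2 * (rgau gamma tau z `^ (a - 1) * tau')
   + lap_g gamma phi z ^+ 2 * ((rgau gamma tau z `^ (a + 1) - gau gamma z `^ (a + 1)) / tau')
  <= E * tau `^ (al / 2).
Proof.
have [G [G0 GB]] := cube_bounded M (@gau_continuous R m k gamma gamma0).
have [D [D0 DB]] := cube_bounded M lap_continuous.
have [F [F0 FB]] := cube_bounded M (smooth_phi [::]).1.
pose n1 := Num.bound (a + 1).
have an : a + 1 <= n1%:R by apply/ltW/archi_boundP; rewrite addr_ge0 ?(ltW a0).
exists (s ^+ 2 * F ^+ 2 * (G + 1) `^ (a - al) + D ^+ 2 * (n1%:R * (G + 1) `^ a)).
split.
  apply: addr_ge0.
    exact: (mulr_ge0 (mulr_ge0 (sqr_ge0 _) (sqr_ge0 _)) (powR_ge0 _ _)).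
  exact: (mulr_ge0 (sqr_ge0 _) (mulr_ge0 (ler0n _ _) (powR_ge0 _ _))).
move=> tau z /andP[tau0 tau1] zM /=.
have T0 := rgau_gt0 gamma tau0 z; set T := rgau _ _ z in T0 *.
have TG : T <= G + 1 by rewrite lerD// (le_trans (ler_norm _))// GB.
have tauT : tau <= T by exact: rgau_ge.
have tD r r' : tau `^ (r + r') = tau `^ r * tau `^ r'.
  by rewrite powRD// (gt_eqF tau0) implybT.
have al_a : al <= a by rewrite ge_min lexx.
have al_1 : al <= 1 by rewrite ge_min lexx orbT.
have sqle (x y : R) : 0 <= y -> `|x| <= y -> x ^+ 2 <= y ^+ 2.
  move=> y0; rewrite ler_norml => /andP[h1 h2].
  by rewrite -subr_ge0 subr_sqr mulr_ge0//; lra.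
rewrite [leRHS]mulrDl; apply: lerD.
  rewrite -[leRHS]mulrA; apply: ler_pM.
  - exact: mulr_ge0 (sqr_ge0 _) (sqr_ge0 _).
  - exact: mulr_ge0 (powR_ge0 _ _) (powR_ge0 _ _).
  - by apply: ler_wpM2l; [exact: sqr_ge0|apply: sqle => //; exact: FB].
  (* The factor with exponent [a - al >= 0] is bounded by the maximum of [T], the one with exponent
     [al - 1 <= 0] by means of [T >= tau]. *)
  have -> : T `^ (a - 1) = T `^ (a - al) * T `^ (al - 1).
    by rewrite -powRD ?(gt_eqF T0) ?implybT//; congr (_ `^ _); ring.
  have -> : tau `^ (al / 2) = tau `^ (al - 1) * tau `^ (1 - al / 2).
    by rewrite -tD; congr (_ `^ _); field.
  rewrite mulrA; apply: ler_wpM2r; first exact: powR_ge0.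
  apply: ler_pM; rewrite ?powR_ge0//.
    by apply: ge0_ler_powR; rewrite ?nnegrE ?subr_ge0 ?(ltW T0) ?addr_ge0.
  rewrite -[al - 1]opprB !powRN lef_pV2 ?posrE ?powR_gt0//.
  by apply: ge0_ler_powR; rewrite ?nnegrE ?subr_ge0 ?(ltW T0) ?(ltW tau0).
rewrite -[leRHS]mulrA; apply: ler_pM; first exact: sqr_ge0.
- rewrite divr_ge0 ?powR_ge0// subr_ge0; apply: ge0_ler_powR;
    rewrite ?nnegrE ?gau_ge0 ?(ltW T0)// ?addr_ge0 ?(ltW a0)//.
  by rewrite lerDl ltW.
- by apply: sqle => //; exact: DB.
rewrite ler_pdivrMr ?powR_gt0// -mulrA -tD [_ / 2 + _]addrC subrK powRr1 ?(ltW tau0)//.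
have NT : 0 <= gau gamma z <= T by rewrite gau_ge0 lerDl ltW.
apply: le_trans (powR_sub_le _ an NT T0) _; first by rewrite addr_gt0.
rewrite addrK [T - _]addrAC subrr add0r ler_wpM2r ?(ltW tau0)//.
by rewrite ler_wpM2l//; apply: ge0_ler_powR; rewrite ?nnegrE ?(ltW a0) ?(ltW T0) ?addr_ge0.
Qed.

Lemma rgau_gradsq_continuous tau r : 0 < tau ->
  continuous (fun z : V => rgau gamma tau z `^ r * gradsq gamma phi z).
Proof.
move=> tau0; apply: continuousM_fun; last exact: gradsq_continuous.
exact: rgau_powR_continuous.
Qed.

Lemma gau_gradsq_continuous : continuous (fun z : V => gau gamma z `^ a * gradsq gamma phi z).
Proof.
apply: continuousM_fun; last exact: gradsq_continuous.
by apply: powR_continuous => //; [exact: gau_continuous|exact: gau_ge0].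
Qed.

(** Integrates the pointwise inequality: both divergences vanish, since every component of the field
    has the factor [phi], which is zero on the faces. The constant [E] may depend on [phi], as it
    disappears with [tau]. *)
Lemma rellich_reg_estimate : exists E, 0 <= E /\ forall tau, 0 < tau <= 1 ->
  t ^+ 2 * boxint M (fun z : V => gau gamma z `^ a * gradsq gamma phi z)
  + mu * c * boxint M (fun z : V => rgau gamma tau z `^ (a + ep) * gradsq gamma phi z)
  <= boxint M (rellich_reg (tau `^ (1 - al / 2))) + E * tau `^ (al / 2).
Proof.
have [E [E0 HE]] := rellich_reg_error.
exists (vol * E); split; first by rewrite mulr_ge0.
move=> tau tau01; have /andP[tau0 tau1] := tau01.
set tau' := tau `^ (1 - al / 2); have tau'0 : 0 < tau' by exact: powR_gt0.
pose Gx i := fieldGx gamma a ep s (- (t * (t + d) ^+ 2)) (- (mu * b)) tau phi i.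
pose Gy j := fieldGy gamma a ep s (- (t * (t + d) ^+ 2)) (- (mu * b)) tau phi j.
have Hx i := fieldx_along gamma0 a ep s (- (t * (t + d) ^+ 2)) (- (mu * b)) tau0 smooth_phi i.
have Hy j := fieldy_along gamma0 a ep s (- (t * (t + d) ^+ 2)) (- (mu * b)) tau0 smooth_phi j.
have cGx i : continuous (Gx i) by have [] := Hx i.
have cGy j : continuous (Gy j) by have [] := Hy j.
have cr r := @rgau_gradsq_continuous tau r tau0.
have cg : continuous (fun z : V => gau gamma z `^ a * gradsq gamma phi z).
  exact: gau_gradsq_continuous.
have cR := rellich_reg_continuous tau'0.
have cZ x (f : V -> R) : continuous f -> continuous (fun z => x * f z).
  by move=> cf; apply: continuousM_fun => //; exact: cst_continuous.
have cA : continuous (fun z : V => t ^+ 2 * (gau gamma z `^ a * gradsq gamma phi z)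
    + mu * c * (rgau gamma tau z `^ (a + ep) * gradsq gamma phi z)).
  by apply: continuousD_fun; apply: cZ.
have cSx : continuous (fun z : V => \sum_(i < m) Gx i z) by exact: continuous_sum_fun.
have cSy : continuous (fun z : V => \sum_(j < k) Gy j z) by exact: continuous_sum_fun.
have cASx := continuousD_fun cA cSx.
have pw z : cube M (m + k) z ->
    t ^+ 2 * (gau gamma z `^ a * gradsq gamma phi z)
    + mu * c * (rgau gamma tau z `^ (a + ep) * gradsq gamma phi z)
    + \sum_(i < m) Gx i z + \sum_(j < k) Gy j z
    <= rellich_reg tau' z + E * tau `^ (al / 2).
  move=> zM; have T0 := rgau_gt0 gamma tau0 z.
  have yY : rgau gamma tau z `^ ep <= Y.
    apply: le_trans (gauY zM); apply: ge0_ler_powR; rewrite ?nnegrE ?(ltW ep0) ?(ltW T0)//.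
      by rewrite addr_ge0 ?gau_ge0.
    by rewrite lerD2l.
  have y0 : 0 < rgau gamma tau z `^ ep by exact: powR_gt0.
  have byY : b * rgau gamma tau z `^ ep <= b * Y by rewrite ler_pM2l.
  have by0 : 0 < b * rgau gamma tau z `^ ep by rewrite mulr_gt0.
  apply: le_trans (lerD (lexx (rellich_reg tau' z)) (HE tau z tau01 zM)).
  apply: le_trans (rellich_reg_ge z tau0 tau'0).
  apply: le_trans (pointwise_le gamma0 t0 d0 b0 c0 tau0 ad QE phi _ _ _); last first.
  - apply: le_trans cbY; rewrite ler_pM2l ?mulr_gt0//.
    rewrite -subr_ge0 subr_sqr mulr_ge0//; first by rewrite subr_ge0 lerD2l.
    by rewrite !addr_ge0 ?(ltW t0) ?(ltW d0) ?(le_trans (ltW by0) byY) ?(ltW by0).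
  - exact: le_trans byY bY.
  - by apply: le_trans cY; rewrite ler_pM2l.
  rewrite !lerD2r ler_pM2l ?exprn_gt0// ler_wpM2r ?gradsq_ge0//.
  apply: ge0_ler_powR; rewrite ?nnegrE ?(ltW a0) ?gau_ge0 ?(ltW T0)//.
  by rewrite lerDl ltW.
have cE : continuous (fun _ : V => E * tau `^ (al / 2)) by exact: cst_continuous.
have Sx0 : boxint M (fun z : V => \sum_(i < m) Gx i z) = 0.
  rewrite (boxint_sum M0 cGx) big1// => i _; apply: (boxint_derive0 M0 (Hx i)) => z zM.
  by rewrite /fieldFx /fieldF (phi_face zM) mul0r.
have Sy0 : boxint M (fun z : V => \sum_(j < k) Gy j z) = 0.
  rewrite (boxint_sum M0 cGy) big1// => j _; apply: (boxint_derive0 M0 (Hy j)) => z zM.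
  by rewrite /fieldFy /fieldF (phi_face zM) mul0r.
have := le_boxint M0 (continuousD_fun cASx cSy) (continuousD_fun cR cE) pw.
rewrite (boxintD M0 cASx cSy) (boxintD M0 cA cSx) (boxintD M0 cR cE) (boxint_cst M0) Sx0 Sy0 !addr0.
rewrite boxintD//; [|exact: cZ..].
by rewrite !boxintZ// mulrA.
Qed.

Variable q : R.
Hypotheses (q12 : 1 < q < 2) (epE : ep = 1 / (4 * p) * (2 - q) / q).

(** The bound of [boxint_rgau_le], uniform in [tau]. *)
Definition holder_cst : R := 4 * M * (2 * M) ^+ (m + k).-1.

Lemma holder_cst_ge0 : 0 <= holder_cst.
Proof. by rewrite /holder_cst !mulr_ge0 ?exprn_ge0 ?mulr_ge0 ?(ltW M0). Qed.

Lemma gradq_continuous :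
  continuous (fun z : V => (gradsq gamma phi z * gau gamma z `^ a) `^ (q / 2)).
Proof.
have /andP[q1 q2] := q12.
apply: powR_continuous; first by lra.
  apply: continuousM_fun; first exact: gradsq_continuous.
  by apply: powR_continuous => //; [exact: gau_continuous|exact: gau_ge0].
by move=> z; rewrite mulr_ge0 ?gradsq_ge0 ?powR_ge0.
Qed.

Lemma boxint_gradq_le (i : 'I_m) tau lam : 0 < tau -> 0 < lam ->
  boxint M (fun z : V => (gradsq gamma phi z * gau gamma z `^ a) `^ (q / 2)) <=
  lam * boxint M (fun z : V => rgau gamma tau z `^ (a + ep) * gradsq gamma phi z)
  + lam `^ (- (q / (2 - q))) * holder_cst.
Proof.
move=> tau0 lam0; have /andP[q1 q2] := q12.
have cr := @rgau_gradsq_continuous tau (a + ep) tau0.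
have cT := @rgau_powR_continuous R m k gamma gamma0 tau tau0 (- (1 / (4 * p))).
have cZ x (f : V -> R) : continuous f -> continuous (fun z => x * f z).
  by move=> cf; apply: continuousM_fun => //; exact: cst_continuous.
apply: (@le_trans _ _ (boxint M (fun z : V =>
  lam * (rgau gamma tau z `^ (a + ep) * gradsq gamma phi z) +
  lam `^ (- (q / (2 - q))) * rgau gamma tau z `^ (- (1 / (4 * p)))))).
  apply: le_boxint => //; first exact: gradq_continuous.
    by apply: continuousD_fun; exact: cZ.
  move=> z _; have T0 := rgau_gt0 gamma tau0 z.
  have v0 : 0 <= gradsq gamma phi z * rgau gamma tau z `^ a.
    by rewrite mulr_ge0 ?gradsq_ge0 ?powR_ge0.
  apply: le_trans (_ : (gradsq gamma phi z * rgau gamma tau z `^ a) `^ (q / 2) <= _).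
    apply: ge0_ler_powR; rewrite ?nnegrE ?mulr_ge0 ?gradsq_ge0 ?powR_ge0//; first by lra.
    rewrite ler_wpM2l ?gradsq_ge0//; apply: ge0_ler_powR;
      rewrite ?nnegrE ?(ltW a0) ?gau_ge0 ?(ltW T0)//.
    by rewrite lerDl ltW.
  apply: le_trans (young_weight (1 / (4 * p)) q12 T0 v0 lam0) _.
  rewrite -epE -mulrA -powRD ?(gt_eqF T0) ?implybT//.
  by rewrite [_ * rgau _ _ _ `^ _]mulrC.
rewrite boxintD//; [|exact: cZ..].
rewrite !boxintZ//; apply: lerD => //; apply: ler_wpM2l; first exact: powR_ge0.
exact: boxint_rgau_le.
Qed.

Lemma boxint_rellich (i : 'I_m) L :
  (forall tau', 0 < tau' -> boxint M (rellich_reg tau') <= L) ->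
  t ^+ 2 * boxint M (fun z : V => gau gamma z `^ a * gradsq gamma phi z)
  + c / (1 + holder_cst) `^ (2 / q) * mu *
    boxint M (fun z : V => (gradsq gamma phi z * gau gamma z `^ a) `^ (q / 2)) `^ (2 / q)
  <= L.
Proof.
move=> HL; have [E [E0 HE]] := rellich_reg_estimate.
set B := boxint M _ in HE *; set S := boxint M _.
have mu0 : 0 < mu by rewrite addr_gt0 ?exprn_gt0 ?mulr_gt0.
have S0 : 0 <= S.
  rewrite -(mulr0 vol) -(boxint_cst M0); apply: le_boxint => //.
  - exact: cst_continuous.
  - exact: gradq_continuous.
  - by move=> z _; exact: powR_ge0.
have h0 : 0 < (1 + holder_cst) `^ (2 / q) by rewrite powR_gt0// ltr_pwDl// holder_cst_ge0.
apply/ler_addgt0Pr => e e0.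
have E10 : 0 < E + 1 by rewrite ltr_wpDl.
(* Small enough for the regularization error to stay below [e / 2]. *)
pose tau := Num.min 1 ((e / 2 / (E + 1)) `^ (2 / al)).
have tau01 : 0 < tau <= 1.
  by rewrite /tau lt_min ltr01 powR_gt0 ?divr_gt0//= ge_min lexx.
have /andP[tau0 tau1] := tau01.
have Etau : E * tau `^ (al / 2) <= e / 2.
  apply: le_trans (_ : E * (e / 2 / (E + 1)) <= _).
    apply: ler_wpM2l => //.
    have -> : e / 2 / (E + 1) = ((e / 2 / (E + 1)) `^ (2 / al)) `^ (al / 2).
      rewrite -powRrM (_ : 2 / al * (al / 2) = 1) ?powRr1 ?divr_ge0 ?(ltW e0) ?(ltW E10)//.
      by field; rewrite gt_eqF.
    apply: ge0_ler_powR; rewrite ?nnegrE ?powR_ge0 ?(ltW tau0) ?divr_ge0 ?(ltW al0)//.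
    by rewrite /tau ge_min lexx orbT.
  rewrite mulrCA ler_piMr ?divr_ge0 ?(ltW e0)// ler_pdivrMr// mul1r lerDl//.
have := HE tau tau01; have := HL _ (powR_gt0 (1 - al / 2) tau0).
have HS := boxint_gradq_le i tau0.
set X := boxint M (fun z : V => rgau _ _ _ `^ _ * _) in HS *.
have X0 : 0 <= X.
  rewrite -(mulr0 vol) -(boxint_cst M0); apply: le_boxint => //.
  - exact: cst_continuous.
  - exact: rgau_gradsq_continuous.
  - by move=> z _; rewrite mulr_ge0 ?powR_ge0 ?gradsq_ge0.
move=> H1 H2.
(* [young_optimize] asks for a positive [X0], whereas [X] may vanish; enlarging [X] by [eta] costs
   the other half of [e]. *)
pose eta := e / 2 / (mu * c).
have mc0 : 0 < mu * c by rewrite mulr_gt0.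
have eta0 : 0 < eta by rewrite !divr_gt0.
have Xe : 0 < X + eta by rewrite ltr_wpDl.
have : S `^ (2 / q) <= (1 + holder_cst) `^ (2 / q) * (X + eta).
  apply: young_optimize => //; first exact: holder_cst_ge0.
  move=> lam lam0; apply: le_trans (HS _ lam0) _.
  by rewrite lerD2r ler_pM2l// lerDl ltW.
move=> /(ler_wpM2l (_ : 0 <= c / (1 + holder_cst) `^ (2 / q) * mu)) H3.
have {}H3 : c / (1 + holder_cst) `^ (2 / q) * mu * S `^ (2 / q) <= mu * c * X + e / 2.
  apply: le_trans (H3 _) _; first by rewrite mulr_ge0 ?divr_ge0 ?(ltW h0) ?(ltW c0) ?(ltW mu0).
  rewrite le_eqVlt; apply/orP; left; apply/eqP; rewrite /eta; field.
  by rewrite !gt_eqF.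
by lra.
Qed.

End improved_rellich.

Lemma derive_off_closed (R : realType) n (K : set 'rV[R]_n) (f : 'rV[R]_n -> R) v :
  closed K -> (forall z, ~ K z -> f z = 0) -> forall z, ~ K z -> 'D_v f z = 0.
Proof.
move=> cK f0 z Kz.
have oK : open (~` K) by rewrite openC.
have fz : \forall w \near z, f w = cst (0 : R) w.
  by apply: filterS (open_nbhs_nbhs (conj oK Kz)) => w /f0.
by rewrite (near_eq_derive v fz) derive_cst.
Qed.

(** * The integrands of the theorem in terms of the gauge *)

Section integrands.
Variables (R : realType) (m k : nat) (gamma alpha : R).
Hypotheses (gamma0 : 0 < gamma) (alpha2 : 2 < alpha).
Local Notation V := 'rV[R]_(m + k).
Local Notation p := (1 + gamma).
Local Notation a := ((alpha - 2) / (2 * p)).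

Let p0 : 0 < p. Proof. by rewrite addr_gt0. Qed.
Let a0 : 0 < a. Proof. by rewrite divr_gt0 ?mulr_gt0 ?subr_gt0. Qed.

Lemma hardy_integrandE (phi : V -> R) z :
  rho gamma z `^ alpha * enorm (grad_g gamma phi z) ^+ 2 / rho gamma z ^+ 2
  = gau gamma z `^ a * gradsq gamma phi z.
Proof.
rewrite enorm_grad_sqr// rhoE// -powRrM.
have b0 : 1 / (2 * p) != 0 by rewrite gt_eqF// divr_gt0 ?mulr_gt0.
(* At the origin the left-hand side is [0] because [0^alpha = 0], the right-hand side because
   [a > 0]. *)
have [g0|g0] := eqVneq (gau gamma z) 0.
  rewrite g0 !powR0 ?mul0r//; first by rewrite gt_eqF.
  by rewrite mulf_neq0// gt_eqF// (lt_trans _ alpha2).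
rewrite mulrAC -powR_mulrn ?powR_ge0// -powRrM -powRB ?g0 ?implybT//.
by congr (_ `^ _ * _); field; rewrite gt_eqF.
Qed.

Lemma gradq_integrandE (phi : V -> R) q z :
  enorm (grad_g gamma phi z) `^ q * rho gamma z `^ (q * (alpha - 2) / 2)
  = (gradsq gamma phi z * gau gamma z `^ a) `^ (q / 2).
Proof.
have -> : enorm (grad_g gamma phi z) `^ q = gradsq gamma phi z `^ (q / 2).
  have {1}-> : q = 2 * (q / 2) by field.
  by rewrite enorm_powR -enorm_sqr enorm_grad_sqr.
have -> : rho gamma z `^ (q * (alpha - 2) / 2) = (gau gamma z `^ a) `^ (q / 2).
  rewrite (@rhoE R m k gamma gamma0 z).
  rewrite -(powRrM (gau gamma z) (1 / (2 * p)) (q * (alpha - 2) / 2)).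
  rewrite -(powRrM (gau gamma z) a (q / 2)).
  congr (_ `^ _).
  field.
  by rewrite gt_eqF.
by rewrite (powRM _ (gradsq_ge0 gamma phi z) (powR_ge0 _ _)).
Qed.

(** Off [x = 0] the power of [gau] in [|grad rho|^2] cancels against part of [rho^alpha], leaving
    [xwt] alone as denominator. *)
Lemma rellich_integrand_ge (phi : V -> R) tau z : 0 < tau -> xsq z != 0 ->
  rellich_reg gamma a phi tau z <=
  rho gamma z `^ alpha * lap_g gamma phi z ^+ 2 / enorm (grad_g gamma (rho gamma) z) ^+ 2.
Proof.
move=> tau0 x0; rewrite enorm_grad_sqr gradsq_rho// (rhoE gamma0) -powRrM.
have g0 := gau_gt0 gamma x0.
have w0 : 0 < xwt gamma z by rewrite powR_gt0// lt_def x0 xsq_ge0.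
have -> : gau gamma z `^ (1 / (2 * p) * alpha) =
    gau gamma z `^ (a + 1) * gau gamma z `^ (1 / p - 1).
  by rewrite -powRD ?(gt_eqF g0) ?implybT//; congr (_ `^ _); field; rewrite gt_eqF.
have e0 : gau gamma z `^ (1 / p - 1) != 0 by rewrite gt_eqF// powR_gt0.
rewrite /rellich_reg [leRHS](_ : _ = gau gamma z `^ (a + 1) * lap_g gamma phi z ^+ 2 / xwt gamma z).
  apply: ler_wpM2l; first by rewrite mulr_ge0 ?powR_ge0 ?sqr_ge0.
  by rewrite lef_pV2 ?posrE ?addr_gt0// lerDl ltW.
by field; rewrite e0 gt_eqF.
Qed.

End integrands.

Lemma int_over_supp (R : realType) n (O : set 'rV[R]_n) (f : 'rV[R]_n -> \bar R) :
  (forall z, ~ O z -> f z = 0%E) -> int_over O f = iint f.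
Proof.
move=> f0; congr iint; apply/funext => z.
by case: ifPn => // /asboolPn /f0.
Qed.

Lemma bounded_set_coord (R : realType) n (O : set 'rV[R]_n) : bounded_set O ->
  exists M, 1 <= M /\ forall z i, O z -> `|z ord0 i| < M.
Proof.
move=> [B [_ HB]]; pose M := Num.max (B + 1) 1.
exists (M + 1); split; first by rewrite lerDr le_max ler01 orbT.
move=> z i Oz; apply: le_lt_trans (_ : `|z ord0 i| <= M) _; last by rewrite ltrDl.
have BM : B < M by rewrite lt_max ltrDl ltr01.
apply: le_trans (HB M BM z Oz); rewrite [leRHS]mx_normrE.
exact: (le_bigmax _ (fun ij : 'I_1 * 'I_n => `|z ij.1 ij.2|) (ord0, i)).
Qed.

Theorem theorem4p7 (R : realType) (m k : nat) (gamma : R)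
    (Omega : set 'rV[R]_(m + k)) (q alpha : R) :
  (0 < m)%N -> (0 < k)%N -> 0 < gamma ->
  bounded_domain Omega -> smooth_boundary Omega -> Omega 0 ->
  1 < q < 2 -> 2 < alpha < Qdim m k gamma ->
  exists C : R, 0 < C /\
    forall phi : 'rV[R]_(m + k) -> R, Cc_inf Omega phi ->
      (int_over Omega (fun z =>
          (rho gamma z `^ alpha * (lap_g gamma phi z) ^+ 2
             / (enorm (grad_g gamma (rho gamma) z)) ^+ 2)%:E)
       >= (((Qdim m k gamma - alpha) / 2) ^+ 2)%:E *
            int_over Omega (fun z =>
              (rho gamma z `^ alpha * (enorm (grad_g gamma phi z)) ^+ 2
                 / (rho gamma z) ^+ 2)%:E)
          + (C * (Qdim m k gamma - alpha) * (Qdim m k gamma + 3 * alpha - 8) / 4)%:E *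
            poweR (int_over Omega (fun z =>
              (enorm (grad_g gamma phi z) `^ q
                 * rho gamma z `^ (q * (alpha - 2) / 2))%:E)) (2 / q))%E.
Proof.
case: m Omega => [//|m] Omega _ k0 gamma0 [_ [_ [bO _]]] _ _ q12 /andP[alpha2 alphaQ].
have /andP[q1 q2] := q12.
have [M [M1 OM]] := bounded_set_coord bO.
have M0 : 0 < M by exact: lt_le_trans M1.
set Q := Qdim m.+1 k gamma in alphaQ *.
pose p := 1 + gamma; have p0 : 0 < p by rewrite addr_gt0.
pose d := alpha - 2; have d0 : 0 < d by rewrite subr_gt0.
pose t := (Q - alpha) / 2; have t0 : 0 < t by rewrite divr_gt0// subr_gt0.
pose a := (alpha - 2) / (2 * p).
have ad : 2 * p * a = d by rewrite /a mulrC divfK// gt_eqF// mulr_gt0.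
have QE : Q = 2 * t + d + 2 by rewrite /t /d; field.
(* Young's inequality with exponents [2/q] and [2/(2 - q)] pairs the gain [T^ep] with the weight
   [T^(-1/(4p))], whose integral is under control. *)
pose ep := 1 / (4 * p) * (2 - q) / q.
have ep0 : 0 < ep.
  rewrite /ep; apply: divr_gt0; last by lra.
  by apply: mulr_gt0; [rewrite divr_gt0// mulr_gt0|lra].
have [G [G0 GB]] := cube_bounded M (@gau_continuous R m.+1 k gamma gamma0).
(* Bounds [T^ep] on the cube for all [tau <= 1]. Then [b] is the largest value with [b Y <= p ep],
   and [c] the largest one allowed by the two remaining conditions. *)
pose Y := (G + 1) `^ ep; have Y0 : 0 < Y by rewrite powR_gt0// ltr_wpDl.
pose b := p * ep / Y; have b0 : 0 < b by apply: divr_gt0 => //; exact: mulr_gt0.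
have h0 : 0 < t + d + b * Y by apply: addr_gt0; [exact: addr_gt0|exact: mulr_gt0].
pose c := Num.min (1 / (2 * Y)) (p * b * ep / (2 * (t + d + b * Y) ^+ 2)).
have pbe0 : 0 < p * b * ep by apply: mulr_gt0 => //; exact: mulr_gt0.
have hh0 : 0 < 2 * (t + d + b * Y) ^+ 2 by apply: mulr_gt0 => //; exact: exprn_gt0.
have c0 : 0 < c.
  rewrite lt_min; apply/andP; split; last exact: divr_gt0.
  by apply: divr_gt0 => //; exact: mulr_gt0.
have cY : c * Y <= 1 / 2.
  apply: le_trans (_ : 1 / (2 * Y) * Y <= _); first by rewrite ler_pM2r// ge_min lexx.
  by rewrite le_eqVlt; apply/orP; left; apply/eqP; field; rewrite gt_eqF.
have bY : b * Y <= p * ep by rewrite /b divfK ?gt_eqF.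
have cbY : 2 * c * (t + d + b * Y) ^+ 2 <= p * b * ep.
  have -> : 2 * c * (t + d + b * Y) ^+ 2 = c * (2 * (t + d + b * Y) ^+ 2) by ring.
  by rewrite -ler_pdivlMr// ge_min lexx orbT.
have gauY (z : 'rV[R]_(m.+1 + k)) : cube M (m.+1 + k) z -> (gau gamma z + 1) `^ ep <= Y.
  move=> zM; apply: ge0_ler_powR; first exact: ltW.
  - by rewrite nnegrE addr_ge0// gau_ge0.
  - by rewrite nnegrE addr_ge0.
  - by apply: lerD => //; exact: le_trans (ler_norm _) (GB z zM).
have hc0 : 0 <= holder_cst m.+1 k M by exact: holder_cst_ge0.
exists (c / (1 + holder_cst m.+1 k M) `^ (2 / q)); split.
  by rewrite divr_gt0 ?powR_gt0 ?ltr_pwDl.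
move=> phi [sphi [K [cK KO phi0]]].
have clK : closed K by apply: compact_closed => //; exact: norm_hausdorff.
have grad0 z : ~ K z -> gradsq gamma phi z = 0.
  move=> Kz; rewrite /gradsq !big1 ?mulr0 ?addr0// => i _;
    by rewrite (derive_off_closed _ clK phi0 Kz) expr0n.
have lap0 z : ~ K z -> lap_g gamma phi z = 0.
  move=> Kz; rewrite /lap_g !big1 ?mulr0 ?addr0// => i _;
    by rewrite (derive_off_closed _ clK (derive_off_closed _ clK phi0) Kz).
have KM z : ~ cube M (m.+1 + k) z -> ~ K z.
  by move=> zM /KO Oz; apply: zM => i; exact/ltW/OM.
have OK z : ~ Omega z -> ~ K z by move=> Oz /KO.
have face (z : 'rV[R]_(m.+1 + k)) i : `|z ord0 i| = M -> phi z = 0.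
  by move=> zM; apply: phi0 => /KO Oz; have := OM z i Oz; rewrite zM ltxx.
have q20 : q / 2 != 0 by rewrite gt_eqF//; lra.
pose hardy z := gau gamma z `^ a * gradsq gamma phi z.
pose gradq z := (gradsq gamma phi z * gau gamma z `^ a) `^ (q / 2).
have chardy : continuous hardy := gau_gradsq_continuous gamma0 d0 ad sphi.
have cgradq : continuous gradq := gradq_continuous gamma0 d0 ad sphi q12.
have hardy0 z : ~ K z -> hardy z = 0 by move=> /grad0 gz; rewrite /hardy gz mulr0.
have gradq0 z : ~ K z -> gradq z = 0 by move=> /grad0 gz; rewrite /gradq gz mul0r powR0.
have -> : int_over Omega (fun z => (rho gamma z `^ alpha
    * enorm (grad_g gamma phi z) ^+ 2 / rho gamma z ^+ 2)%:E) = (boxint M hardy)%:E.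
  rewrite -(iint_boxint M0 chardy); last by move=> z /KM; exact: hardy0.
  rewrite -(@int_over_supp _ _ Omega); last by move=> z /OK Kz; rewrite /= hardy0.
  congr int_over; apply/funext => z; congr EFin; exact: hardy_integrandE.
have -> : int_over Omega (fun z => (enorm (grad_g gamma phi z) `^ q
    * rho gamma z `^ (q * (alpha - 2) / 2))%:E) = (boxint M gradq)%:E.
  rewrite -(iint_boxint M0 cgradq); last by move=> z /KM; exact: gradq0.
  rewrite -(@int_over_supp _ _ Omega); last by move=> z /OK Kz; rewrite /= gradq0.
  congr int_over; apply/funext => z; congr EFin; exact: gradq_integrandE.
set L := int_over _ _.
have HL tau : 0 < tau -> ((boxint M (rellich_reg gamma a phi tau))%:E <= L)%E.
  move=> tau0; apply: (@le_boxint_iint _ _ M0 (m + k)%N).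
  - exact: (rellich_reg_continuous gamma0 d0 ad sphi tau0).
  - move=> z; apply: divr_ge0; first exact: mulr_ge0 (powR_ge0 _ _) (sqr_ge0 _).
    exact: addr_ge0 (xwt_ge0 _ _) (ltW tau0).
  - by move=> z /KM/lap0 lz; rewrite /rellich_reg lz expr0n /= mulr0 mul0r.
  - move=> z; case: ifPn => // _; rewrite lee_fin.
    exact: divr_ge0 (mulr_ge0 (powR_ge0 _ _) (sqr_ge0 _)) (sqr_ge0 _).
  (* As [m] has become a successor, the first coordinate is [x_1]; where it is nonzero, [x] is
     nonzero. *)
  - move=> z z0; have x0 : xsq (z : 'rV[R]_(m.+1 + k)) != 0.
      rewrite gt_eqF//; apply: lt_le_trans (sqr_xc_le ord0 _).
      rewrite lt_def sqr_ge0 andbT sqrf_eq0 /xc.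
      by rewrite (_ : lshift k ord0 = ord0)//; exact/val_inj.
    case: ifPn => [_|/asboolPn/OK/lap0 lz]; last first.
      by rewrite /rellich_reg lz expr0n /= mulr0 mul0r.
    by rewrite lee_fin; exact: rellich_integrand_ge.
rewrite poweR_EFin -!EFinM -EFinD.
(* An infinite left-hand side makes the claim trivial; [HL] excludes [-oo]. *)
have [->|[l Ll]] : L = +oo%E \/ exists l, L = l%:E.
  by case: L HL => [l|_|/(_ 1 ltr01)//]; [right; exists l|left].
  exact: leey.
rewrite Ll in HL *; rewrite lee_fin.
have := @boxint_rellich R m.+1 k gamma M gamma0 M1 t d b ep c a t0 d0 b0 c0 ep0 ad QE
  Y gauY cY bY cbY phi sphi face q q12 erefl ord0 l
  (fun tau tau0 => HL tau tau0).
rewrite -/hardy -/gradq.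
apply: le_trans; rewrite le_eqVlt; apply/orP; left; apply/eqP; congr (_ + _ * _).
by move: (c / _) => C; rewrite /t /d; field.
Qed.
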